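(* Fix $\beta>0$. There exist positive constants $c$ and $d$, a compact set $K$, and a function $V:\Omega\to[1,\infty)$ (in the domain $D(G_Y)$), with $V(x)\to\infty$ as $|x|\to\infty$ and $V_1(0,x_2)=V_2(0,x_2)$ for all $x_2\ge0$, such that $$G_YV(x)\le -c\,V(x)+d\,1(x\in K),\qquad x\in\Omega .$$ The function $V$, the constants $c,d$, and the set $K$ all depend on $\beta$.
   Context: $\Omega=(-\infty,0]\times[0,\infty)$; $f_i=\partial f/\partial x_i$ and $f_{ij}$ are partial derivatives, understood as one-sided derivatives on $\partial\Omega$. $C^2(\Omega)$ is the set of twice continuously differentiable functions on $\Omega$ in this sense. Let $\{(Y_1(t),Y_2(t))\}_{t\ge0}$ be the diffusion on $\Omega$ that is the unique solution of $$Y_1(t)=Y_1(0)+\sqrt2\,W(t)-\beta t+\int_0^t(-Y_1(s)+Y_2(s))\,ds-U(t),\qquad Y_2(t)=Y_2(0)+U(t)-\int_0^tY_2(s)\,ds,$$ where $W$ is a standard Brownian motion and $U$ is the unique non-decreasing, non-negative process with right-continuous paths with left limits satisfying $\int_0^\infty1(Y_1(t)<0)\,dU(t)=0$. Extended generator: $D(G_Y)$ is the set of functions $f:\Omega\to\mathbb R$ for which there is a measurable $g:\Omega\to\mathbb R$ such that for every $x\in\Omega$ and $t\ge0$, $$\mathbb E_xf(Y_1(t),Y_2(t))-\mathbb E_xf(Y_1(0),Y_2(0))=\mathbb E_x\int_0^tg(Y_1(s),Y_2(s))\,ds,\qquad \int_0^t\mathbb E_x|g(Y_1(s),Y_2(s))|\,ds<\infty,$$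 and one writes $G_Yf=g$. For $f\in C^2(\Omega)$ with $f_1(0,x_2)=f_2(0,x_2)$ for all $x_2\ge 0$, the generator acts as $$G_Yf(x)=(-x_1+x_2-\beta)f_1(x)-x_2f_2(x)+f_{11}(x),\qquad x\in\Omega .$$ *)

(* Defs.v *)
From HB Require Import structures.
From mathcomp Require Import all_boot all_order all_algebra.
From mathcomp Require Import all_classical all_reals all_analysis.

Set Implicit Arguments.
Unset Strict Implicit.
Unset Printing Implicit Defensive.

Import Order.TTheory GRing.Theory Num.Theory.
Import numFieldNormedType.Exports.

Local Open Scope classical_set_scope.
Local Open Scope ring_scope.

Definition Omega (R : realType) : set (R * R) :=
  [set x | x.1 <= 0 /\ 0 <= x.2].

(* The increment h is restricted to those keeping the point in Omega, so that
   on the boundary of Omega these are the one-sided derivatives.  Functions on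
   Omega are represented by functions on R * R whose values outside Omega are
   never used. *)
Definition has_partial1 (R : realType) (f : R * R -> R) (x : R * R) (l : R) :=
  (f (x.1 + h, x.2) - f x) / h
    @[h --> within [set h | Omega (x.1 + h, x.2)] 0^'] --> l.

Definition has_partial2 (R : realType) (f : R * R -> R) (x : R * R) (l : R) :=
  (f (x.1, x.2 + h) - f x) / h
    @[h --> within [set h | Omega (x.1, x.2 + h)] 0^'] --> l.

(* Processes are indexed by R; only the times t >= 0 matter. *)
Record brownian_motion (R : realType) (d : measure_display)
    (T : measurableType d) (P : probability T R)
    (W : R -> {RV P >-> R}) : Prop := {
  brownian_at0 : forall w, W 0 w = 0 ;
  brownian_continuous :
    forall w, {within `[0, +oo[%classic, continuous (fun t => W t w)} ;
  (* the second parameter of normal_prob is the standard deviation *)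
  brownian_gaussian : forall s t : R, 0 <= s -> s < t ->
    forall B : set R, measurable B ->
    P [set w | B (W t w - W s w)] = normal_prob 0 (Num.sqrt (t - s)) B ;
  brownian_independent : forall (n : nat) (t : nat -> R),
    0 <= t 0%N -> (forall i, t i <= t i.+1) ->
    forall B : nat -> set R, (forall i, measurable (B i)) ->
    P (\bigcap_(i < n) [set w | B i (W (t i.+1) w - W (t i) w)]) =
      (\prod_(i < n) P [set w | B i (W (t i.+1) w - W (t i) w)%R])%E
}.

(* (Y1, Y2) is driven by W and started at the point x of Omega.  The equations
   determine U, Y1 and Y2 path by path from W and x, so the law of (Y1, Y2)
   depends only on x and beta. *)
Record is_diffusion (R : realType) (beta : R) (x : R * R)
    (d : measure_display) (T : measurableType d) (P : probability T R)
    (W U Y1 Y2 : R -> {RV P >-> R}) : Prop := {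
  diffusion_brownian : brownian_motion W ;
  diffusion_start : forall w, (Y1 0 w, Y2 0 w) = x ;
  diffusion_state : forall w (t : R), 0 <= t -> Omega (Y1 t w, Y2 t w) ;
  diffusion_U_ge0 : forall w (t : R), 0 <= t -> 0 <= U t w ;
  diffusion_U_nondecreasing :
    forall w (s t : R), 0 <= s -> s <= t -> U s w <= U t w ;
  diffusion_U_right_continuous : forall w (t : R), 0 <= t ->
    U s w @[s --> t^'+] --> U t w ;
  diffusion_U_left_limits : forall w (t : R), 0 < t ->
    cvg (U s w @[s --> t^'-]) ;
  (* dU is the Stieltjes measure of the path of U extended by 0 to negative
     times *)
  diffusion_U_boundary : forall w, exists F : cumulative R R,
    [/\ forall t : R, 0 <= t -> F t = U t w,
        forall t : R, t < 0 -> F t = 0 &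
        (\int[lebesgue_stieltjes_measure F]_(t in `[0%R, +oo[)
           (\1_[set s | (Y1 s w < 0)%R] t)%:E = 0)%E] ;
  (* Rintegral has a default value on non-integrable functions *)
  diffusion_integrable1 : forall w (t : R), 0 <= t ->
    lebesgue_measure.-integrable `[0, t] (fun s => (Y1 s w)%:E) ;
  diffusion_integrable2 : forall w (t : R), 0 <= t ->
    lebesgue_measure.-integrable `[0, t] (fun s => (Y2 s w)%:E) ;
  diffusion_eq1 : forall w (t : R), 0 <= t ->
    Y1 t w = Y1 0 w + Num.sqrt 2 * W t w - beta * t
      + \int[lebesgue_measure]_(s in `[0, t]) (- Y1 s w + Y2 s w) - U t w ;
  diffusion_eq2 : forall w (t : R), 0 <= t ->
    Y2 t w = Y2 0 w + U t w - \int[lebesgue_measure]_(s in `[0, t]) Y2 s w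
}.

(* f \in D(G_Y) and G_Y f = g.  The expectation E_x is taken on an arbitrary
   probability space carrying the diffusion started at x; integrability of
   f (Y1 t, Y2 t) is what makes E_x f (Y1 t, Y2 t) meaningful. *)
Definition extended_generator (R : realType) (beta : R) (f g : R * R -> R) :
    Prop :=
  measurable_fun (@Omega R) g /\
  forall (x : R * R) (d : measure_display) (T : measurableType d)
    (P : probability T R) (W U Y1 Y2 : R -> {RV P >-> R}),
  Omega x -> is_diffusion beta x W U Y1 Y2 ->
  forall t : R, 0 <= t ->
  [/\ P.-integrable setT (fun w => (f (Y1 t w, Y2 t w))%:E),
      (\int[lebesgue_measure]_(s in `[0%R, t])
         \int[P]_w `|(g (Y1 s w, Y2 s w))%:E| < +oo)%E &
      ('E_P[fun w => f (Y1 t w, Y2 t w)] - 'E_P[fun w => f (Y1 0%R w, Y2 0%R w)]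
       = \int[P]_w \int[lebesgue_measure]_(s in `[0%R, t])
           (g (Y1 s w, Y2 s w))%:E)%E].

(* Main.v *)
(** Let th = beta / 4.  The Lyapunov function is
      V (x1, x2) = e^(th x1) + e^(- th x1) + e^(th x2) + e^(2 th x1 + th x2).
    On x1 = 0 the terms of V_1 and V_2 balance.  The generator turns
    e^(- th x1) into roughly th x1 e^(- th x1), and the sum of the last two
    exponentials into th e^(th x2) h with
      h = - x2 (1 - e^(2 th x1)) - (2 x1 + beta) e^(2 th x1);
    for - x1 >= beta / 4 the first term of h makes it tend to - oo with x2,
    and for - x1 <= beta / 4 the second one is below a negative constant.

    V belongs to the domain of the generator because, over a grid of [0, t],
    V (Y_t) - V (Y_0) is a sum of mean zero terms, in which an increment of W
    is independent of the present state, plus a remainder that converges path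
    by path to the time integral of GV: U is continuous and grows only where
    Y1 = 0, where the balance of the exponents cancels its contribution.
    Every path is bounded by an affine function of S = sup |W|, so that a
    multiple of e^(r S), which is integrable by Levy's maximal inequality,
    dominates the remainder.  The independence holds because Y_s is the limit
    of an explicit scheme that involves only finitely many increments of W. *)
Require Import Defs.
From HB Require Import structures.
From mathcomp Require Import all_boot all_order all_algebra.
From mathcomp Require Import all_classical all_reals all_analysis.
From mathcomp Require Import measurable_realfun.
From mathcomp Require Import ring lra.
Import Order.TTheory GRing.Theory Num.Theory.
Import numFieldNormedType.Exports.
Local Open Scope classical_set_scope.
Local Open Scope ring_scope.

Set Implicit Arguments.
Unset Strict Implicit.

(** * Continuous functions on [0, +oo[ *)

(** The definitions supply the diffusion through its path equations on an arbitrary space, without a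
    filtration. This dictates the choice of exponentials of linear forms: over [p, q] an increment
    of W multiplies e^(a x1 + b x2) by a factor whose mean e^(a^2 (q - p)) is known exactly, so the
    second-order term of the generator appears as a Gaussian mean. What is left has bounded
    variation and is estimated on each path.

    The exponents come in two pairs. The derivative along the reflection direction (-1, 1) at x1 = 0
    is th for e^(- th x1) and th e^(th x2) for e^(th x2); e^(th x1) and e^(2 th x1 + th x2) are the
    correctors that cancel these. At x1 = 0 the generator turns the second pair into th e^(th x2) (4
    th - 2 beta), which is negative for 0 < th < beta / 2. The middle value th = beta / 4 also gives
    4 th^2 = th beta. *)

Definition continuous_nonneg (R : realType) (f : R -> R) : Prop :=
  forall s, 0 <= s -> forall e, 0 < e ->
  exists2 d, 0 < d & forall r, 0 <= r -> `|r - s| < d -> `|f r - f s| < e.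

Lemma within_continuous_nonneg (R : realType) (f : R -> R) :
  {within `[0, +oo[%classic, continuous f} <-> continuous_nonneg f.
Proof.
have in0 (x : R) : x \in `[0, +oo[ = (0 <= x) by rewrite in_itv /= andbT.
split=> [/subspace_continuousP cf s s0 e e0|cf].
  have := cf s; rewrite /= in0 => /(_ s0)/cvgrPdist_lt/(_ e e0).
  rewrite near_withinE => -[d /= d0 h]; exists d => // r r0 rs.
  by rewrite distrC; apply: h; rewrite /= ?in0 // distrC.
apply/subspace_continuousP => s; rewrite /= in0 => s0.
apply/cvgrPdist_lt => e e0; rewrite near_withinE.
have [d d0 h] := cf s s0 e e0; exists d => //= r rs; rewrite in0 => r0.
by rewrite distrC; apply: h => //; rewrite distrC.
Qed.

Lemma continuous_nonneg_uniform (R : realType) (f : R -> R) (T e : R) :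
  continuous_nonneg f -> 0 < e ->
  exists2 d, 0 < d & forall r s, 0 <= r <= T -> 0 <= s <= T ->
    `|r - s| < d -> `|f r - f s| < e.
Proof.
move=> cf e0.
have /compact_near_coveringP ncov := @segment_compact R 0 T.
pose Q (d s : R) := 0 <= s -> forall r, 0 <= r -> `|r - s| < d -> `|f r - f s| < e.
(* Compactness in near-covering form, the parameter being a radius that tends to 0 from the right:
   local validity of [Q] for all small radii gives one radius for the whole segment. Half of the
   radius at s pays for moving s, half for r. *)
have [|d /= d0 h] := ncov R 0^'+ Q _.
  move=> s; rewrite /= in_itv /= => /andP[s0 _].
  have e20 : 0 < e / 2 by rewrite divr_gt0.
  have [d d0 h] := cf s s0 _ e20.
  have d20 : 0 < d / 2 by rewrite divr_gt0.
  exists (ball s (d / 2), [set x | 0 < x < d / 2]) => /=.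
    split; first exact: nbhsx_ballx.
    exists (d / 2) => //= x /=; rewrite sub0r normrN => xd x0.
    by rewrite x0 (le_lt_trans (ler_norm _)).
  move=> [s' d'] [/= ss' /andP[d'0 d'd]] s'0 r r0 rs'.
  have h1 : `|f r - f s| < e / 2.
    apply: h => //; rewrite (_ : r - s = (r - s') - (s - s')); last by ring.
    by rewrite (le_lt_trans (ler_normB _ _)) // [ltRHS]splitr ltrD // (lt_trans rs').
  have h2 : `|f s' - f s| < e / 2.
    apply: h => //; rewrite distrC (lt_trans ss') //.
    by rewrite ltr_pdivrMr // mulr_natr mulr2n ltrDl.
  rewrite (_ : f r - f s' = (f r - f s) - (f s' - f s)); last by ring.
  by rewrite (le_lt_trans (ler_normB _ _)) // [ltRHS]splitr ltrD.
exists (d / 2) => [|r s /andP[r0 rT] /andP[s0 sT] rs]; first by rewrite divr_gt0.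
apply: (h (d / 2)) => //=.
- by rewrite sub0r normrN gtr0_norm ?divr_gt0 // ltr_pdivrMr // mulr_natr mulr2n ltrDl.
- by rewrite divr_gt0.
- by rewrite in_itv /= s0.
Qed.

(** The bound is an integer so that a least one exists; [brownian_exp_dominated] uses the least
    integer bound of a Brownian path. *)
Lemma continuous_nonneg_bounded (R : realType) (f : R -> R) (T : R) :
  continuous_nonneg f -> exists n : nat, forall s, 0 <= s <= T -> `|f s| <= n%:R.
Proof.
move=> cf; have [d d0 h] := @continuous_nonneg_uniform R f T 1 cf ltr01.
have /compact_near_coveringP ncov := @segment_compact R 0 T.
pose Q (n : nat) (s : R) := 0 <= s -> `|f s| <= n%:R.
have [|n _ /= hn] := ncov nat \oo Q _.
  move=> s; rewrite /= in_itv /= => /andP[s0 _].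
  have [d' d'0 h'] := cf s s0 _ ltr01.
  pose N := Num.bound (`|f s| + 1).
  exists (ball s d', [set n | (N <= n)%N]) => /=.
    by split; [exact: nbhsx_ballx|exists N].
  move=> [s' n] [/= ss' Nn] s'0.
  have := h' s' s'0; rewrite distrC => /(_ ss') hs.
  have : `|f s'| <= `|f s| + 1.
    rewrite -{1}(subrK (f s) (f s')) (le_trans (ler_normD _ _)) // addrC.
    by rewrite lerD2l ltW.
  move=> /le_trans; apply; apply: (@le_trans _ _ N%:R); last by rewrite ler_nat.
  by apply/ltW/archi_boundP; rewrite addr_ge0.
by exists n => s /andP[s0 sT]; apply: hn => //=; rewrite ?in_itv /= ?s0.
Qed.

(** * Expectations *)

(** Factorization on rectangles makes the law of [(X, Y)] the product of the two laws; Tonelli then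
    splits the integral. *)
Lemma independent_integralM (R : realType) (d : measure_display)
    (T : measurableType d) (P : probability T R) (X Y : T -> R) :
  measurable_fun setT X -> measurable_fun setT Y ->
  (forall w, 0 <= X w) -> (forall w, 0 <= Y w) ->
  (forall A B : set R, measurable A -> measurable B ->
    P (X @^-1` A `&` Y @^-1` B) = (P (X @^-1` A) * P (Y @^-1` B))%E) ->
  (\int[P]_w (X w * Y w)%:E = \int[P]_w (X w)%:E * \int[P]_w (Y w)%:E)%E.
Proof.
move=> mX mY X0 Y0 XY.
pose X' : {mfun T >-> R} := HB.pack X (isMeasurableFun.Build _ _ _ _ _ mX).
pose Y' : {mfun T >-> R} := HB.pack Y (isMeasurableFun.Build _ _ _ _ _ mY).
have mZ : measurable_fun setT (fun w => (X w, Y w)).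
  exact: measurable_fun_pair.
pose Z : {mfun T >-> (R * R)%type} :=
  HB.pack (fun w => (X w, Y w)) (isMeasurableFun.Build _ _ _ _ _ mZ).
(* Absolute values make the integrand nonnegative on the whole plane, as Tonelli requires; on the
   values of [(X, Y)] they change nothing. *)
pose f (z : R * R) : \bar R := (`|z.1| * `|z.2|)%:E.
have mf : measurable_fun setT f.
  apply/measurable_EFinP; apply: measurable_funM;
    exact: measurableT_comp.
have f0 z : (0 <= f z)%E by rewrite lee_fin mulr_ge0.
pose m1 := distribution P X'; pose m2 := distribution P Y'.
transitivity (\int[distribution P Z]_z f z)%E.
  rewrite ge0_integral_distribution //; apply: eq_integral => w _.
  by rewrite /f /= !ger0_norm.
have prodE A : measurable A -> (m1 \x m2)%E A = distribution P Z A.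
  by move=> mA; apply: product_measure_unique.
rewrite (eq_measure_integral (m1 \x m2)%E); last first.
  by move=> A mA _; exact: (esym (prodE A mA)).
rewrite fubini_tonelli1 // /fubini_F /f /=.
have mabs : measurable_fun setT (fun x : R => `|x|%:E).
  by apply/measurable_EFinP; exact: normr_measurable.
have abs0 (x : R) : (0 <= `|x|%:E)%E by rewrite lee_fin.
transitivity (\int[m1]_x (`|x|%:E * \int[m2]_y `|y|%:E))%E.
  apply: eq_integral => x _; under eq_integral do rewrite EFinM.
  by rewrite ge0_integralZl.
rewrite ge0_integralZr //; last by apply: integral_ge0.
rewrite /m1 /m2 !ge0_integral_distribution //.
congr (_ * _)%E; apply: eq_integral => w _ /=; by rewrite ger0_norm.
Qed.

(** Completing the square: e^(c x) times the centred density is e^(c^2 s^2 / 2) times the density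
    with mean c s^2, which has mass 1. *)
Lemma integral_normal_expR (R : realType) (c s : R) : 0 < s ->
  (\int[normal_prob 0 s]_x (expR (c * x))%:E = (expR (c ^+ 2 * s ^+ 2 / 2))%:E)%E.
Proof.
move=> s0.
pose mu := @lebesgue_measure R.
have s1 : s != 0 by rewrite gt_eqF.
have mexp : measurable_fun setT (fun x : R => (expR (c * x))%:E).
  by apply/measurable_EFinP; apply: measurableT_comp => //; exact: measurable_funM.
have numu := normal_prob_dominates 0 s.
(* The Radon-Nikodym derivative agrees almost everywhere with [normal_pdf], both having the same
   integral over every measurable set. *)
pose g := Radon_Nikodym_SigmaFinite.f (normal_prob 0 s) mu.
transitivity (\int[mu]_x ((expR (c * x))%:E * g x))%E.
  by rewrite Radon_Nikodym_SigmaFinite.change_of_variables // => x; rewrite lee_fin expR_ge0.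
have gE : ae_eq mu setT g (fun x => (normal_pdf 0 s x)%:E).
  apply: integral_ae_eq => //.
  - exact: Radon_Nikodym_SigmaFinite.f_integrable.
  - by apply/measurable_EFinP; exact: measurable_normal_pdf.
  - by move=> E _ mE; rewrite -Radon_Nikodym_SigmaFinite.f_integral.
transitivity (\int[mu]_x ((expR (c * x))%:E * (normal_pdf 0 s x)%:E))%E.
  apply: ae_eq_integral => //; last exact: ae_eqe_mul2l.
  - apply: emeasurable_funM => //; apply: (measurable_int mu).
    exact: Radon_Nikodym_SigmaFinite.f_integrable.
  - by apply: emeasurable_funM => //; apply/measurable_EFinP; exact: measurable_normal_pdf.
transitivity (\int[mu]_x ((expR (c ^+ 2 * s ^+ 2 / 2))%:E * (normal_pdf (c * s ^+ 2) s x)%:E))%E.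
  apply: eq_integral => x _; rewrite -!EFinM; congr EFin.
  rewrite !normal_pdfE // /normal_fun mulrCA [RHS]mulrCA; congr (_ * _).
  rewrite -!expRD; congr expR.
  by field.
rewrite ge0_integralZl //; last 2 first.
- by apply/measurable_EFinP; exact: measurable_normal_pdf.
- by move=> x _; rewrite lee_fin normal_pdf_ge0.
by rewrite integral_normal_pdf mule1.
Qed.

Lemma real_dominated_convergence (R : realType) (d : measure_display)
    (T : measurableType d) (P : {measure set T -> \bar R})
    (f_ : nat -> T -> R) (f : T -> R) (g : T -> \bar R) :
  (forall n, measurable_fun setT (f_ n)) ->
  (forall w, f_ ^~ w @ \oo --> f w) ->
  P.-integrable setT g -> (forall n w, (`|f_ n w|%:E <= g w)%E) ->
  P.-integrable setT (fun w => (f w)%:E) /\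
  (\int[P]_w (f_ n w)%:E)%E @[n --> \oo] --> (\int[P]_w (f w)%:E)%E.
Proof.
move=> mf_ f_f ig f_g.
have [] := @dominated_convergence _ T R P setT measurableT
  (fun n w => (f_ n w)%:E) (fun w => (f w)%:E) g.
- by move=> n; exact/measurable_EFinP.
- by apply/measurable_EFinP; apply: (measurable_fun_cvg mf_) => w _; exact: f_f.
- apply: aeW => w _; apply: cvg_comp (f_f w) _; exact: cvg_id.
- exact: ig.
- by apply: aeW => w n _; exact: f_g.
by [].
Qed.

Lemma real_monotone_convergence (R : realType) (d : measure_display)
    (T : measurableType d) (P : {measure set T -> \bar R})
    (f_ : nat -> T -> R) (f : T -> R) :
  (forall n, measurable_fun setT (f_ n)) -> (forall n w, 0 <= f_ n w) ->
  (forall w, nondecreasing_seq (f_ ^~ w)) ->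
  (forall w, f_ ^~ w @ \oo --> f w) ->
  (\int[P]_w (f_ n w)%:E)%E @[n --> \oo] --> (\int[P]_w (f w)%:E)%E.
Proof.
move=> mf_ f_0 f_nd f_f.
have -> : (\int[P]_w (f w)%:E = \int[P]_w (limn (fun n => (f_ n w)%:E)))%E.
  apply: eq_integral => w _; apply/esym/cvg_lim => //.
  by apply: cvg_comp (f_f w) _; exact: cvg_id.
apply: cvg_monotone_convergence => //.
- by move=> n; exact/measurable_EFinP.
- by move=> n w _; rewrite lee_fin.
- by move=> w _ m n mn; rewrite lee_fin f_nd.
Qed.

(** * Increments and maxima of Brownian motion *)

Section brownian.
Context (R : realType) (d : measure_display) (T : measurableType d)
  (P : probability T R) (W : R -> {RV P >-> R}).
Hypothesis BM : brownian_motion W.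

(** When t 0 = 0, a pi-system generating the sigma-algebra of W at the times t 0, ..., t k. It is
    phrased with increments because [brownian_independent] is. *)
Definition cylinders (t : nat -> R) (k : nat) : set (set T) :=
  [set A | exists2 B : nat -> set R, (forall i, measurable (B i)) &
     A = \bigcap_(i < k) [set w | B i (W (t i.+1) w - W (t i) w)]].

Lemma measurable_increment (s r : R) (B : set R) : measurable B ->
  measurable [set w | B (W r w - W s w)].
Proof.
move=> mB.
have mf : measurable_fun setT (fun w => W r w - W s w).
  by apply: measurable_funB.
by rewrite -[X in measurable X]setTI; exact: mf.
Qed.

Lemma measurable_cylinders (t : nat -> R) (k : nat) :
  cylinders t k `<=` measurable.
Proof.
move=> _ [B mB ->]; rewrite bigcap_mkord.
by apply: bigsetI_measurable => i _; exact: measurable_increment.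
Qed.

Lemma cylinders_setI (t : nat -> R) (k : nat) : setI_closed (cylinders t k).
Proof.
move=> _ _ [A mA ->] [B mB ->]; exists (fun i => A i `&` B i).
  by move=> i; exact: measurableI.
by rewrite -bigcapI.
Qed.

(** As functions of [A], both sides are finite measures. They agree on the cylinders, which are
    stable under intersection, hence on the generated sigma-algebra. *)
Lemma increment_independent (t : nat -> R) (k : nat) (r : R)
    (A : set T) (B : set R) :
  0 <= t 0%N -> (forall i, t i <= t i.+1) -> t k <= r -> measurable B ->
  <<s cylinders t k >> A ->
  P (A `&` [set w | B (W r w - W (t k) w)]) =
  (P A * P [set w | B (W r w - W (t k) w)%R])%E.
Proof.
move=> t0 tS tkr mB sA.
have mE := measurable_increment (t k) r mB.
set E := [set w | _] in mE *.
have PE_fin : P E \is a fin_num by rewrite fin_num_measure.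
pose m1 := mrestr P mE.
pose c : {nonneg R} := NngNum (fine_ge0 (measure_ge0 P E)).
pose m2 := mscale c P.
have m1E X : m1 X = P (X `&` E) by [].
have m2E X : m2 X = (P E * P X)%E by rewrite /m2 /mscale/= fineK.
suff : m1 A = m2 A by rewrite m1E m2E muleC.
have tmono (B0 : nat -> set R) : (forall i, measurable (B0 i)) ->
    P ((\bigcap_(i < k) [set w | B0 i (W (t i.+1) w - W (t i) w)]) `&` E) =
    ((\prod_(i < k) P [set w | B0 i (W (t i.+1) w - W (t i) w)%R]) * P E)%E.
  move=> mB0.
  (* The grid is frozen at r after index k, so that increment number k runs from t k to r; [B'] puts
     [B] there and [brownian_independent] applies with k + 1 factors. *)
  pose t' i := if (i <= k)%N then t i else r.
  pose B' i := if i == k then B else B0 i.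
  have t'0 : 0 <= t' 0%N by [].
  have t'S i : t' i <= t' i.+1.
    by rewrite /t'; case: (ltngtP i k) => // ->.
  have mB' i : measurable (B' i) by rewrite /B'; case: ifP.
  have := brownian_independent BM k.+1 t'0 t'S mB'.
  rewrite !bigcap_mkord big_ord_recr/= big_ord_recr/=.
  have e1 : [set w | B' k (W (t' k.+1) w - W (t' k) w)] = E.
    by rewrite /B' eqxx /t' ltnn leqnn.
  have e2 (i : 'I_k) : [set w | B' i (W (t' i.+1) w - W (t' i) w)] =
     [set w | B0 i (W (t i.+1) w - W (t i) w)].
    by rewrite /B' /t' ltn_ord (ltnW (ltn_ord i)) (ltn_eqF (ltn_ord i)).
  rewrite e1.
  under eq_bigr do rewrite e2.
  move=> ->; congr (_ * _)%E.
  by apply: eq_bigr => i _; rewrite e2.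
apply: (g_sigma_algebra_measure_unique_trace (cylinders t k) setT) => //.
- by move=> X [/measurable_cylinders].
- move=> X Y [GX _] [GY _]; split => //; exact: cylinders_setI.
- by rewrite [LHS]m1E [RHS]m2E setTI probability_setT mule1.
- move=> X [[B0 mB0 ->] _].
  rewrite [LHS]m1E [RHS]m2E tmono // muleC; congr (_ * _)%E.
  by rewrite (brownian_independent BM k t0 tS mB0).
- by rewrite [ltLHS]m1E setTI (le_lt_trans (probability_le1 _ _)) // ltry.
- rewrite (_ : [set X | cylinders t k X /\ X `<=` setT] = cylinders t k) //.
  by apply/seteqP; split => [X []|].
Qed.

Notation cylinder_type t k := (g_sigma_algebraType (cylinders t k)).

Lemma measurable_increment_cylinders (t : nat -> R) (j k : nat) : (j < k)%N ->
  measurable_fun [set: cylinder_type t k]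
    (fun w : cylinder_type t k => W (t j.+1) w - W (t j) w).
Proof.
move=> jk _ B mB; rewrite setTI; apply: sub_sigma_algebra.
exists (fun i => if i == j then B else setT); first by move=> i; case: ifP.
apply/seteqP; split => w /=.
  by move=> Bw i _ /=; case: eqP => // ->.
by move=> /(_ j jk) /=; rewrite eqxx.
Qed.

Lemma measurable_brownian_cylinders (t : nat -> R) (j k : nat) : t 0%N = 0 ->
  (j <= k)%N -> measurable_fun [set: cylinder_type t k]
    (fun w : cylinder_type t k => W (t j) w : R).
Proof.
move=> t0; elim: j => [_|j IH jk].
  rewrite (_ : (fun w => _) = cst 0); first exact: measurable_cst.
  by apply/funext => w /=; rewrite t0 (brownian_at0 BM).
rewrite (_ : (fun w => _) =
  (fun w : cylinder_type t k => W (t j) w) \+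
  (fun w : cylinder_type t k => W (t j.+1) w - W (t j) w)); last first.
  by apply/funext => w /=; rewrite addrC subrK.
apply: measurable_funD; first exact: IH (ltnW jk).
exact: measurable_increment_cylinders.
Qed.

Lemma increment_mgf (s t c : R) : 0 <= s -> s <= t ->
  (\int[P]_w (expR (c * (W t w - W s w)))%:E =
   (expR (c ^+ 2 * (t - s) / 2))%:E)%E.
Proof.
move=> s0; rewrite le_eqVlt => /predU1P[->|st].
  under eq_integral do rewrite subrr mulr0 expR0.
  by rewrite subrr mulr0 mul0r expR0 integral_cst // mul1e; exact: probability_setT.
have mX : measurable_fun setT
    (fun w => W t w - W s w : measurableTypeR R).
  exact: (measurable_funB (f := W t) (g := W s)).
pose X : {mfun T >-> measurableTypeR R} := HB.pack (fun w => W t w - W s w)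
  (isMeasurableFun.Build _ _ _ _ _ mX).
have mexp : measurable_fun setT (fun x : measurableTypeR R => (expR (c * x))%:E).
  by apply/measurable_EFinP; apply: measurableT_comp => //; exact: measurable_funM.
transitivity (\int[distribution P X]_x (expR (c * x))%:E)%E.
  by rewrite ge0_integral_distribution // => x; rewrite lee_fin expR_ge0.
have ts : 0 < Num.sqrt (t - s) by rewrite sqrtr_gt0 subr_gt0.
transitivity (\int[normal_prob 0 (Num.sqrt (t - s))]_x (expR (c * x))%:E)%E.
  apply: eq_measure_integral => A mA _.
  exact: (brownian_gaussian BM s0 st mA).
by rewrite integral_normal_expR // sqr_sqrtr // subr_ge0 ltW.
Qed.

(** The normal density is even. The sign [e] lets one statement serve both W and -W. *)
Lemma increment_sign (s t e : R) : 0 <= s -> s <= t -> e \in [:: 1; -1] ->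
  ((2^-1)%:E <= P [set w | (0 <= e * (W t w - W s w))%R])%E.
Proof.
move=> s0; rewrite le_eqVlt => /predU1P[->|st] e1.
  rewrite (_ : [set w | _] = setT); last first.
    by apply/seteqP; split => w //= _; rewrite subrr mulr0.
  by rewrite probability_setT lee_fin invf_le1 ?ler1n.
set sg := Num.sqrt (t - s).
have ts : 0 < sg by rewrite sqrtr_gt0 subr_gt0.
have sg1 : sg != 0 by rewrite gt_eqF.
have mpos : measurable [set x : R | 0 <= x] by rewrite -set_itvcy.
have mB (a : R) : measurable [set x : R | 0 <= a * x].
  have mf : measurable_fun setT (fun x : R => a * x) by exact: measurable_funM.
  by have := mf measurableT _ mpos; rewrite setTI.
rewrite (brownian_gaussian BM s0 st (mB e)).
have half : normal_prob 0 sg [set x : R | 0 <= x] = (2^-1)%:E.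
  have := integral_normal_pdf 0 sg.
  rewrite ge0_symfun_integralT; last 3 first.
  - by move=> x; exact: normal_pdf_ge0.
  - exact: continuous_normal_pdf.
  - by move=> x /=; rewrite !normal_pdfE // /normal_fun !subr0 sqrrN.
  rewrite -/(normal_prob 0 sg _) => h.
  have fin : normal_prob 0 sg [set x : R | 0 <= x] \is a fin_num.
    exact: fin_num_measure.
  move: h; rewrite -(fineK fin) -EFinM => -[h]; congr EFin.
  by move: h; set u := fine _; lra.
move: e1; rewrite !inE => /orP[] /eqP ->.
  rewrite (_ : [set x | _] = [set x : R | 0 <= x]) ?half//.
  by apply/seteqP; split => x /=; rewrite mul1r.
set v := normal_prob 0 sg _.
have vfin : v \is a fin_num by apply: fin_num_measure; exact: mB.
(* For e = -1: the two closed half-lines cover the line and one has mass 1/2, so the other has at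
   least 1/2. *)
have : (normal_prob 0 sg setT <= (2^-1)%:E + v)%E.
  rewrite -half; apply: le_trans (measureU2 _ _ _) => //; last exact: mB.
  rewrite le_measure ?inE //; first by apply: measurableU => //; exact: mB.
  move=> x _ /=; have [?|?] := leP 0 x; first by left.
  by right; rewrite mulN1r oppr_ge0 ltW.
rewrite [leLHS]probability_setT -(fineK vfin) -EFinD !lee_fin.
by set u := fine _; lra.
Qed.

(** [seqDU F k] says that k is the first grid index at which e W exceeds a. It depends on increments
    before t k only, whereas e times the increment from t k to t n is nonnegative with probability
    at least 1/2, independently. When both occur, e W (t n) > a; summing over the disjoint
    first-passage events costs a factor 2. *)
Lemma levy_inequality (t : nat -> R) (n : nat) (e a : R) :
  t 0%N = 0 -> (forall i, t i <= t i.+1) -> e \in [:: 1; -1] ->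
  (P (\big[setU/set0]_(k < n.+1) [set w | (a < e * W (t k) w)%R])
   <= 2%:E * P [set w | (a < e * W (t n) w)%R])%E.
Proof.
move=> t0 tS e1.
have tmono i j : (i <= j)%N -> t i <= t j.
  by move/nondecreasing_seqP : (tS); exact.
pose F k := [set w | a < e * W (t k) w].
pose E k := [set w | 0 <= e * (W (t n) w - W (t k) w)].
have mgt : measurable [set x : R | a < e * x].
  have mf : measurable_fun setT (fun x : R => e * x) by exact: measurable_funM.
  have := mf measurableT `]a, +oo[%classic (measurable_itv _).
  rewrite setTI; congr measurable; apply/seteqP.
  by split => x /=; rewrite in_itv /= andbT.
have mge : measurable [set x : R | 0 <= e * x].
  have mf : measurable_fun setT (fun x : R => e * x) by exact: measurable_funM.
  have := mf measurableT `[0, +oo[%classic (measurable_itv _).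
  rewrite setTI; congr measurable; apply/seteqP.
  by split => x /=; rewrite in_itv /= andbT.
have mF k : measurable (F k).
  by rewrite -[X in measurable X]setTI; exact: (measurable_funP (W (t k)) measurableT _ mgt).
have mE k : measurable (E k) by exact: measurable_increment mge.
have mFc j k : (j <= k)%N -> measurable (F j : set (cylinder_type t k)).
  move=> jk; have mW := measurable_brownian_cylinders t0 jk.
  have := mW measurableT _ mgt.
  by rewrite setTI.
have sF k : <<s cylinders t k >> (seqDU F k).
  suff : measurable (seqDU F k : set (cylinder_type t k)) by [].
  rewrite /seqDU; apply: measurableD; first exact: mFc.
  apply: (@bigsetU_measurable _ (cylinder_type t k)) => j _.
  by apply: mFc; exact: ltnW (ltn_ord j).
have mD k : measurable (seqDU F k)
  by apply: measurableD => //; exact: bigsetU_measurable.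
have half k : (k <= n)%N ->
    (P (seqDU F k) <= 2%:E * P (seqDU F k `&` E k))%E.
  move=> kn; have -> : P (seqDU F k `&` E k) = (P (seqDU F k) * P (E k))%E.
    by apply: (increment_independent _ tS _ mge) => //; [rewrite t0|exact: tmono].
  have h : ((2^-1)%:E <= P (E k))%E.
    by apply: increment_sign => //; [rewrite -t0|]; exact: tmono.
  apply: (@le_trans _ _ (2%:E * (P (seqDU F k) * (2^-1)%:E))%E); last first.
    by rewrite lee_pmul2l // lee_wpmul2l.
  by rewrite muleCA -EFinM divff // mule1.
have tD : trivIset setT (seqDU F) by exact: trivIset_seqDU.
rewrite (bigsetU_seqDU F) (measure_bigsetU P mD tD).
apply: (@le_trans _ _ (\sum_(k < n.+1) 2%:E * P (seqDU F k `&` E k))%E).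
  by apply: lee_sum => k _; apply: half; rewrite -ltnS.
rewrite -ge0_sume_distrr // lee_pmul2l //.
have mDE k : measurable (seqDU F k `&` E k) by exact: measurableI.
rewrite -(measure_bigsetU P mDE (trivIset_setIr tD)).
rewrite le_measure ?inE //; [exact: bigsetU_measurable|exact: mF n|].
rewrite -(bigcup_mkord n.+1 (fun i => seqDU F i `&` E i)) => w [k /= _ [[Fk _] Ek]].
rewrite /F /E /= in Fk Ek.
by rewrite (lt_le_trans Fk) // -subr_ge0 -mulrBr.
Qed.

(** Chernoff's bound: Markov's inequality for e^(mu e W t), with e^2 = 1. *)
Lemma brownian_tail (t e a mu : R) : 0 <= t -> e \in [:: 1; -1] -> 0 <= mu ->
  (P [set w | (a < e * W t w)%R] <=
   (expR (mu ^+ 2 * t / 2) * expR (- (mu * a)))%:E)%E.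
Proof.
move=> t0 e1 mu0; have := increment_mgf (e * mu) (lexx 0) t0.
have -> : (e * mu) ^+ 2 * (t - 0) / 2 = mu ^+ 2 * t / 2.
  by move: e1; rewrite !inE => /orP[] /eqP ->; rewrite subr0; ring.
set A := [set w | _] => mgf.
have mA : measurable A.
  have mf : measurable_fun setT (fun w => e * W t w) by exact: measurable_funM.
  have := mf measurableT `]a, +oo[%classic (measurable_itv _).
  rewrite setTI; congr measurable; apply/seteqP.
  by split => x /=; rewrite in_itv /= andbT.
have mI : measurable_fun setT (fun w => (\1_A w : R)%:E).
  by apply/measurable_EFinP; exact: measurable_indic.
rewrite mulrC expRN EFinM lee_pdivlMl ?expR_gt0 // -mgf.
apply: (@le_trans _ _ (\int[P]_w ((expR (mu * a))%:E * (\1_A w)%:E))%E).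
  rewrite ge0_integralZl // ?lee_fin ?expR_ge0 //.
  by rewrite integral_indic // setIT.
apply: ge0_le_integral => //.
- exact: measurable_funeM.
- apply/measurable_EFinP; apply: measurableT_comp => //.
  by apply: measurable_funM => //; exact: measurable_funB.
- move=> w _; rewrite -EFinM lee_fin indicE; case: (boolP (w \in A)) => [|_].
    rewrite inE /A /= mulr1 ler_expR => aw.
    rewrite (brownian_at0 BM) subr0 -mulrA mulrCA; apply: ler_wpM2l => //.
    exact: ltW.
  by rewrite mulr0 expR_ge0.
Qed.

(** S is the least integer bound of |W| on [0, T0], and [D' j] is the event that |W| exceeds j on
    some dyadic grid. If S = j + 1, then |W| exceeds j at some time, by continuity also at a dyadic
    one, so term j of the series [G] is at least e^(c S). The 1 in [G] covers S = 0. *)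
Lemma brownian_exp_dominated (T0 c : R) : 0 <= T0 -> 0 <= c ->
  exists2 G : T -> \bar R, P.-integrable setT G & forall w, exists S : R,
    [/\ 0 <= S, forall s, 0 <= s <= T0 -> `|W s w| <= S &
      ((expR (c * S))%:E <= G w)%E].
Proof.
move=> T00 c0.
pose t m i : R := T0 * i%:R / (2 ^ m)%:R.
have p2 m : 0 < (2 ^ m)%:R :> R by rewrite ltr0n expn_gt0.
have t0 m : t m 0%N = 0 by rewrite /t mulr0 mul0r.
have tS m i : t m i <= t m i.+1.
  by rewrite /t ler_pM2r ?invr_gt0 // ler_wpM2l // ler_nat.
have tT m : t m (2 ^ m)%N = T0 by rewrite /t mulfK // gt_eqF.
pose D m j := \big[setU/set0]_(k < (2 ^ m).+1) [set w | (j%:R < `|W (t m k) w|)%R].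
have mgt r (a : R) : measurable [set w | a < `|W r w|].
  have mf : measurable_fun setT (fun w => `|W r w|) by exact: measurableT_comp.
  have := mf measurableT `]a, +oo[%classic (measurable_itv _).
  rewrite setTI; congr measurable; apply/seteqP.
  by split => x /=; rewrite in_itv /= andbT.
have mD m j : measurable (D m j) by apply: bigsetU_measurable => k _.
have inD m j w : D m j w <-> exists2 k, (k <= 2 ^ m)%N & j%:R < `|W (t m k) w|.
  rewrite /D -(bigcup_mkord _ (fun k => [set w | (j%:R < `|W (t m k) w|)%R])).
  by split => [[k /= km h]|[k km h]]; exists k.
have ndD j : nondecreasing_seq (D^~ j).
  apply/nondecreasing_seqP => m; apply/subsetPset => w /inD[k km h].
  apply/inD; exists (2 * k)%N; first by rewrite expnS leq_mul2l.
  rewrite (_ : t m.+1 (2 * k)%N = t m k) // /t expnS !natrM.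
  by field; rewrite !pnatr_eq0 ?expn_eq0.
pose D' j := \bigcup_m D m j.
have mD' j : measurable (D' j) by exact: bigcup_measurable.
(* The rate c + 1 beats the weights e^(c (j + 1)) and leaves terms of order e^(-j). In [K], one
   factor 2 is Levy's and the other stands for the two signs of W. *)
pose mu := c + 1; pose K := 4 * expR (mu ^+ 2 * T0 / 2).
have mu0 : 0 <= mu by rewrite addr_ge0.
have PD m j : (P (D m j) <= (K * expR (- (mu * j%:R)))%:E)%E.
  pose De e := \big[setU/set0]_(k < (2 ^ m).+1) [set w | (j%:R < e * W (t m k) w)%R].
  have mgte e r (a : R) : measurable [set w | a < e * W r w].
    have mf : measurable_fun setT (fun w => e * W r w) by exact: measurable_funM.
    have := mf measurableT `]a, +oo[%classic (measurable_itv _).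
    rewrite setTI; congr measurable; apply/seteqP.
    by split => x /=; rewrite in_itv /= andbT.
  have mDe e : measurable (De e) by apply: bigsetU_measurable => k _; exact: mgte.
  have PDe e : e \in [:: 1; -1] ->
      (P (De e) <= (K / 2 * expR (- (mu * j%:R)))%:E)%E.
    move=> e1; apply: (le_trans (levy_inequality _ _ (t0 m) (tS m) e1)).
    have -> : K / 2 * expR (- (mu * j%:R)) =
        2 * (expR (mu ^+ 2 * T0 / 2) * expR (- (mu * j%:R))) by rewrite /K; field.
    by rewrite EFinM lee_pmul2l // tT brownian_tail.
  have -> : (K * expR (- (mu * j%:R)))%:E = ((K / 2 * expR (- (mu * j%:R)))%:E +
      (K / 2 * expR (- (mu * j%:R)))%:E)%E by rewrite -EFinD; congr EFin; field.
  apply: (@le_trans _ _ (P (De 1 `|` De (-1)))).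
    rewrite le_measure ?inE //; first exact: measurableU.
    move=> w /inD[k km]; rewrite lter_normr => /orP[] h; [left|right];
      rewrite /De -(bigcup_mkord _ (fun k => [set w | (j%:R < _ * W (t m k) w)%R]));
      by exists k; rewrite //= ?mul1r ?mulN1r.
  by rewrite (le_trans (measureU2 _ _ _)) // leeD // PDe // !inE eqxx ?orbT.
have PD' j : (P (D' j) <= (K * expR (- (mu * j%:R)))%:E)%E.
  have := nondecreasing_cvg_mu (mu := P) (mD^~ j) (mD' j) (ndD j).
  move=> /cvg_lim <- //; apply: lime_le; last by apply: nearW => m; exact: PD.
  apply: ereal_nondecreasing_is_cvgn => m n mn.
  by rewrite le_measure ?inE //; apply/subsetPset/ndD.
pose g j w := ((expR (c * j.+1%:R))%:E * (\1_(D' j) w)%:E)%E.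
have g0 j w : (0 <= g j w)%E by rewrite /g -EFinM lee_fin mulr_ge0 ?expR_ge0.
have mg j : measurable_fun setT (g j).
  apply: measurable_funeM; apply/measurable_EFinP.
  exact: measurable_indic.
pose G w := (1 + \sum_(j <oo) g j w)%E.
have G0 w : (0 <= G w)%E by rewrite adde_ge0 // nneseries_ge0.
have mG0 : measurable_fun setT (fun w => \sum_(j <oo) g j w)%E.
  exact: ge0_emeasurable_sum.
exists G.
  apply/integrableP; split; first exact: emeasurable_funD.
  under eq_integral do rewrite gee0_abs //.
  rewrite /G ge0_integralD //; last by move=> w _; exact: nneseries_ge0.
  have -> : (\int[P]__ 1 = 1 :> \bar R)%E.
    by rewrite integral_cst // mul1e; exact: probability_setT.
  rewrite integral_nneseries //.
  apply: (@le_lt_trans _ _ (1 + (2 * K * expR c)%:E)%E); last by rewrite -EFinD ltry.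
  rewrite leeD2l //; apply: lime_le.
    by apply: is_cvg_nneseries => n _ _; exact: integral_ge0.
  apply: nearW => n.
  (* As e >= 2, the factor e^(-j) is replaced by 2^(-j), whose partial sums stay below 2. *)
  have half : forall n, \sum_(0 <= j < n) (2^-1 : R) ^+ j <= 2 - 2 * (2^-1) ^+ n.
    elim=> [|k IH]; first by rewrite big_nil expr0; lra.
    rewrite big_nat_recr //= exprS; move: IH.
    by set u := _ ^+ _; set v := \sum_(_ <= _ < _) _; lra.
  apply: (@le_trans _ _ (\sum_(0 <= j < n) (K * expR c * (2^-1) ^+ j)%:E)%E).
    apply: lee_sum => j _; rewrite /g ge0_integralZl //; last first.
      by apply/measurable_EFinP; exact: measurable_indic.
    rewrite integral_indic // setIT.
    apply: (@le_trans _ _ ((expR (c * j.+1%:R))%:E * (K * expR (- (mu * j%:R)))%:E)%E).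
      by apply: lee_wpmul2l => //; exact: PD'.
    rewrite -EFinM lee_fin mulrCA -expRD -mulrA ler_pM2l; last first.
      by rewrite mulr_gt0 // expR_gt0.
    have -> : c * j.+1%:R - mu * j%:R = c - j%:R by rewrite /mu -natr1; ring.
    rewrite expRD ler_pM2l ?expR_gt0 // expRN exprVn lef_pV2 ?posrE ?expR_gt0 ?exprn_gt0 //.
    rewrite -[j%:R]mul1r expRM_natr lerXn2r ?nnegrE ?expR_ge0 //.
    by rewrite (le_trans _ (expR_ge1Dx _)).
  rewrite sumEFin lee_fin -mulr_sumr.
  have -> : 2 * K * expR c = K * expR c * 2 by ring.
  rewrite ler_wpM2l ?mulr_ge0 ?expR_ge0 //.
  by rewrite (le_trans (half n)) // lerBlDr lerDl mulr_ge0 // exprn_ge0.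
move=> w.
have cW : continuous_nonneg (fun s => W s w).
  exact/within_continuous_nonneg/(brownian_continuous BM).
have exS : exists n : nat, `[< forall s, 0 <= s <= T0 -> `|W s w| <= n%:R >].
  by have [n hn] := continuous_nonneg_bounded T0 cW; exists n; apply/asboolP.
case: (ex_minnP exS) => n /asboolP hn nmin; exists n%:R; split => //.
case: n hn nmin => [|j] hn nmin.
  by rewrite mulr0 expR0 leeDl // nneseries_ge0.
have [s sT jW] : exists2 s, 0 <= s <= T0 & j%:R < `|W s w|.
  apply: contrapT => h; have : (j.+1 <= j)%N.
    apply: nmin; apply/asboolP => s sT; rewrite leNgt; apply/negP => jW.
    by apply: h; exists s.
  by rewrite ltnn.
have Djw : D' j w.
  have e0 : 0 < `|W s w| - j%:R by rewrite subr_gt0.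
  have /andP[s0 sT0] := sT.
  have [d' d'0 hd] := cW s s0 _ e0.
  have [m hm] : exists m : nat, T0 / (2 ^ m)%:R < d'.
    exists (Num.bound (T0 / d')); rewrite ltr_pdivrMr // mulrC -ltr_pdivrMr //.
    apply: (lt_trans (archi_boundP _)); first by rewrite divr_ge0 // ltW.
    by rewrite ltr_nat ltn_expl.
  have [T0p|T0n] := ltP 0 T0; last first.
    exists 0%N => //; apply/inD; exists 0%N => //; rewrite t0.
    by have -> : 0 = s by apply/eqP; rewrite eq_le s0 (le_trans sT0).
  (* Index of the last point of the dyadic grid not after s; it is within T0 / 2^m < d' of s, where
     |W| still exceeds j. *)
  pose k := Num.truncn (s * (2 ^ m)%:R / T0).
  have x0 : 0 <= s * (2 ^ m)%:R / T0 by rewrite divr_ge0 ?mulr_ge0 // ltW.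
  have /andP[k1 k2] := truncn_itv x0; rewrite -/k in k1 k2.
  exists m => //; apply/inD; exists k.
    rewrite -(ler_nat R) (le_trans k1) // ler_pdivrMr // mulrC.
    by rewrite ler_wpM2l // ltW.
  have ks : t m k <= s.
    by rewrite /t ler_pdivrMr // mulrC -ler_pdivlMr.
  have sk : s < t m k + T0 / (2 ^ m)%:R.
    rewrite /t -mulrDl -{2}[T0]mulr1 -mulrDr ltr_pdivlMr // mulrC.
    by rewrite natr1 mulrC [ltRHS]mulrC -ltr_pdivrMr.
  have : `|W (t m k) w - W s w| < `|W s w| - j%:R.
    apply: hd; first by rewrite /t divr_ge0 ?mulr_ge0.
    rewrite distrC ger0_norm ?subr_ge0 // (lt_trans _ hm) //.
    by rewrite ltrBlDl.
  have := ler_distD (W (t m k) w) (W s w) 0.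
  rewrite !subr0 distrC; set a := `|_ - _|; set b := `|W s w|; lra.
have : ((expR (c * j.+1%:R))%:E <= \sum_(i <oo) g i w)%E.
  apply: (@le_trans _ _ (g j w)).
    by rewrite /g indicE mem_set // mule1.
  apply: (@le_trans _ _ (\sum_(0 <= i < j.+1) g i w)%E).
    by rewrite big_nat_recr //= leeDr // sume_ge0.
  exact: nneseries_lim_ge.
move=> /le_trans; apply; by rewrite leeDr.
Qed.

Lemma cylinder_independent_integralM (t : nat -> R) (k : nat) (r c : R)
    (X : T -> R) :
  t 0%N = 0 -> (forall i, t i <= t i.+1) -> t k <= r ->
  measurable_fun [set: cylinder_type t k] (X : cylinder_type t k -> R) ->
  (forall w, 0 <= X w) ->
  (\int[P]_w (X w * expR (c * (W r w - W (t k) w)))%:E =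
   \int[P]_w (X w)%:E * \int[P]_w (expR (c * (W r w - W (t k) w)))%:E)%E.
Proof.
move=> t0 tS tkr mX X0.
have sub A : <<s cylinders t k >> A -> measurable A.
  apply: smallest_sub; last exact: measurable_cylinders.
  exact: sigma_algebra_measurable.
have XA A : measurable A -> <<s cylinders t k >> (X @^-1` A).
  by move=> mA; have := mX measurableT A mA; rewrite setTI.
have mY : measurable_fun setT (fun x : R => expR (c * x)).
  by apply: measurableT_comp => //; exact: measurable_funM.
apply: independent_integralM => //.
- by move=> _ A mA; rewrite setTI; apply: sub; exact: XA.
- apply: (measurableT_comp mY); exact: measurable_funB.
- move=> A B mA mB.
  have mB' : measurable ((fun x : R => expR (c * x)) @^-1` B).
    by have := mY measurableT B mB; rewrite setTI.
  apply: (increment_independent (t := t) (k := k) _ tS tkr mB' (XA _ mA)).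
  by rewrite t0.
Qed.

(** Pointwise limits inherit the factorization. [X] may have infinite mean, so it is first cut off
    at N: dominated convergence in n, with N times the exponential as bound, then monotone
    convergence in N. Each [Xn n] may live on its own grid; what the grids share is their end point
    s. *)
Lemma adapted_integralM (s r c : R) (X : T -> R) (Xn : nat -> T -> R)
    (t : nat -> nat -> R) (k : nat -> nat) :
  0 <= s -> s <= r ->
  (forall n, t n 0%N = 0) -> (forall n i, t n i <= t n i.+1) ->
  (forall n, t n (k n) = s) ->
  (forall n, measurable_fun [set: cylinder_type (t n) (k n)]
     (Xn n : cylinder_type (t n) (k n) -> R)) ->
  (forall n w, 0 <= Xn n w) -> (forall w, Xn ^~ w @ \oo --> X w) ->
  (\int[P]_w (X w * expR (c * (W r w - W s w)))%:E =
   \int[P]_w (X w)%:E * (expR (c ^+ 2 * (r - s) / 2))%:E)%E.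
Proof.
move=> s0 sr t0 tS tk mXn Xn0 XnX.
set Y := fun w => expR (c * (W r w - W s w)).
have Y0 w : 0 <= Y w by exact: expR_ge0.
have mY : measurable_fun setT Y.
  apply: measurableT_comp => //; apply: measurable_funM => //.
  exact: measurable_funB.
have X0 w : 0 <= X w.
  have /cvg_lim <- // := XnX w; apply: limr_ge; last exact: nearW.
  by apply/cvg_ex; exists (X w); exact: XnX.
have intY : (\int[P]_w (Y w)%:E = (expR (c ^+ 2 * (r - s) / 2))%:E)%E.
  exact: increment_mgf.
have iY : P.-integrable setT (fun w => (Y w)%:E).
  apply/integrableP; split; first exact/measurable_EFinP.
  under eq_integral do rewrite gee0_abs ?lee_fin //.
  by rewrite intY ltry.
have mXnT n : measurable_fun setT (Xn n).
  move=> _ A mA; have := mXn n measurableT A mA.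
  apply: smallest_sub; last exact: measurable_cylinders.
  exact: sigma_algebra_measurable.
have mX : measurable_fun setT X.
  by apply: (measurable_fun_cvg mXnT) => w _; exact: XnX.
have mmin (Z : T -> R) (N : nat) : measurable_fun setT Z ->
    measurable_fun setT (fun w => Num.min (Z w) N%:R).
  by move=> mZ; exact: measurable_minr.
have minE N : (\int[P]_w (Num.min (X w) N%:R * Y w)%:E =
   \int[P]_w (Num.min (X w) N%:R)%:E * (expR (c ^+ 2 * (r - s) / 2))%:E)%E.
  have cvgmin w : (fun n => Num.min (Xn n w) N%:R) @ \oo --> Num.min (X w) N%:R.
    apply/cvgrPdist_lt => e e0; have /cvgrPdist_lt/(_ e e0) := XnX w.
    apply: filterS => n; apply: le_lt_trans.
    have := ler_norm (X w - Xn n w); have := ler_norm (- (X w - Xn n w)).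
    rewrite normrN; set A := `|_| => h1 h2; rewrite ler_norml.
    by case: (leP (X w) N%:R) => ?; case: (leP (Xn n w) N%:R) => ?; lra.
  have bd (Z : T -> R) w : 0 <= Z w -> 0 <= Num.min (Z w) N%:R <= N%:R.
    by move=> Z0; rewrite le_min Z0 ler0n ge_min lexx orbT.
  have [||||i1 c1] := @real_dominated_convergence _ _ _ P
    (fun n w => Num.min (Xn n w) N%:R * Y w) (fun w => Num.min (X w) N%:R * Y w)
    (fun w => (N%:R)%:E * (Y w)%:E)%E.
  - by move=> n; apply: measurable_funM => //; exact: mmin.
  - by move=> w; apply: cvgM; [exact: cvgmin|exact: cvg_cst].
  - exact: integrableZl.
  - move=> n w; have /andP[b1 b2] := bd _ _ (Xn0 n w).
    by rewrite -EFinM lee_fin ger0_norm ?mulr_ge0 // ler_wpM2r.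
  have [||||i2 c2] := @real_dominated_convergence _ _ _ P
    (fun n w => Num.min (Xn n w) N%:R) (fun w => Num.min (X w) N%:R)
    (fun w => (N%:R)%:E)%E.
  - by move=> n; exact: mmin.
  - by move=> w; exact: cvgmin.
  - exact: finite_measure_integrable_cst.
  - move=> n w; have /andP[b1 b2] := bd _ _ (Xn0 n w).
    by rewrite lee_fin ger0_norm.
  have c3 : (\int[P]_w (Num.min (Xn n w) N%:R)%:E *
      (expR (c ^+ 2 * (r - s) / 2))%:E)%E @[n --> \oo] -->
    (\int[P]_w (Num.min (X w) N%:R)%:E * (expR (c ^+ 2 * (r - s) / 2))%:E)%E.
    by apply: cvgeZr.
  move: c1; under eq_fun => n.
    rewrite /Y -(tk n) cylinder_independent_integralM //; last 3 first.
    - by rewrite tk.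
    - by apply: measurable_minr.
    - by move=> w; have /andP[] := bd _ _ (Xn0 n w).
    rewrite tk -/Y; over.
  rewrite intY => c1; exact: cvg_unique c1 c3.
have Nnd (Z : R) (Z0 : 0 <= Z) :
    {homo (fun N : nat => Num.min Z N%:R) : m n / (m <= n)%N >-> m <= n}.
  by move=> m n mn; rewrite le_min !ge_min lexx /= ler_nat mn orbT.
have minX w : (fun N : nat => Num.min (X w) N%:R) @ \oo --> X w.
  apply: cvg_near_cst; exists (Num.bound (X w)) => // N /= hN.
  apply/min_idPl; apply: (le_trans (ltW (archi_boundP (X0 w)))).
  by rewrite ler_nat.
have c1 : (\int[P]_w (Num.min (X w) N%:R * Y w)%:E)%E @[N --> \oo] -->
    (\int[P]_w (X w * Y w)%:E)%E.
  apply: (@real_monotone_convergence _ _ _ P (fun N w => Num.min (X w) N%:R * Y w)).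
  - by move=> n; apply: measurable_funM => //; exact: mmin.
  - by move=> n w; rewrite mulr_ge0 // le_min X0 ler0n.
  - by move=> w m n mn; rewrite ler_wpM2r // Nnd.
  - by move=> w; apply: cvgM; [exact: minX|exact: cvg_cst].
have c2 : (\int[P]_w (Num.min (X w) N%:R)%:E)%E @[N --> \oo] -->
    (\int[P]_w (X w)%:E)%E.
  apply: (@real_monotone_convergence _ _ _ P (fun N w => Num.min (X w) N%:R)).
  - by move=> n; exact: mmin.
  - by move=> n w; rewrite le_min X0 ler0n.
  - by move=> w m n mn; rewrite Nnd.
  - exact: minX.
have c3 : (\int[P]_w (Num.min (X w) N%:R)%:E *
      (expR (c ^+ 2 * (r - s) / 2))%:E)%E @[N --> \oo] -->
    (\int[P]_w (X w)%:E * (expR (c ^+ 2 * (r - s) / 2))%:E)%E.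
  by apply: cvgeZr.
move: c1; under eq_fun do rewrite minE.
move=> c1; exact: cvg_unique c1 c3.
Qed.

End brownian.

(** * Paths of the reflected diffusion *)

Lemma segment_continuous_nonneg (R : realType) (f : R -> R) :
  (forall T, 0 < T -> {within `[0, T], continuous f}) -> continuous_nonneg f.
Proof.
move=> cf s s0 e e0.
have s10 : 0 < s + 1 by rewrite ltr_wpDl.
have /subspace_continuousP := cf _ s10 => /(_ s).
rewrite /= in_itv /= s0 lerDl ler01 => /(_ isT)/cvgrPdist_lt/(_ e e0).
rewrite near_withinE => -[d /= d0 h].
exists (Num.min d 1); first by rewrite lt_min d0 ltr01.
move=> r r0; rewrite lt_min => /andP[rd r1].
rewrite distrC; apply: h; rewrite /= ?in_itv /= ?r0 1?distrC //.
by rewrite -lerBlDl (le_trans (ler_norm _)) // ltW.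
Qed.

(** * Primitives of integrable paths *)

Section primitive.
Context (R : realType) (f : R -> R).
Let mu := @lebesgue_measure R.
Hypothesis if_ : forall t, 0 <= t -> mu.-integrable `[0, t] (fun s => (f s)%:E).

Lemma primitive_continuous_nonneg :
  continuous_nonneg (fun t => \int[mu]_(s in `[0, t]) f s).
Proof.
apply: segment_continuous_nonneg => T T0.
exact: (parameterized_integral_continuous (ltW T0) (if_ (ltW T0))).
Qed.

Let increment_bounds (p q : R) : 0 <= p -> p <= q ->
  [/\ \int[mu]_(s in `[0, q]) f s - \int[mu]_(s in `[0, p]) f s =
        \int[mu]_(s in `]p, q]) f s,
    mu.-integrable `]p, q] (EFin \o f),
    forall c, mu.-integrable `]p, q] (EFin \o cst c) &
    forall c, \int[mu]_(s in `]p, q]) (cst c s) = c * (q - p)].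
Proof.
move=> p0 pq; have q0 := le_trans p0 pq; split.
- by rewrite (@Rintegral_itvB R f (BLeft 0) (BRight q) p) //; exact: if_.
- apply: integrableS (if_ q0) => //; apply: subset_itvr.
  by rewrite bnd_simp.
- move=> c; apply: (@integrableS _ _ _ mu `[p, q]) => //.
    by apply: subset_itvr; rewrite bnd_simp.
  apply: continuous_compact_integrable; first exact: segment_compact.
  by apply: continuous_subspaceT => x; exact: cvg_cst.
- move=> c; rewrite Rintegral_cst //; congr (_ * _).
  suff h : (mu `]p, q]%classic = (q - p)%:E)%E by exact: (congr1 fine h).
  apply: etrans (lebesgue_measure_itv `]p, q]) _; rewrite /= lte_fin; move: pq.
  by rewrite le_eqVlt => /predU1P[->|->] //; rewrite ltxx subrr.
Qed.

Lemma primitive_increment_ge (p q a : R) : 0 <= p -> p <= q ->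
  (forall s, p <= s <= q -> a <= f s) ->
  a * (q - p) <= \int[mu]_(s in `[0, q]) f s - \int[mu]_(s in `[0, p]) f s.
Proof.
move=> p0 pq fa; have [-> ifpq icst <-] := increment_bounds p0 pq.
apply: (@le_Rintegral _ _ _ mu `]p, q]%classic (cst a) f (measurable_itv _) (icst _) ifpq) => s /=.
by rewrite in_itv /= => /andP[ps sq]; rewrite fa // (ltW ps).
Qed.

Lemma primitive_increment_le (p q a : R) : 0 <= p -> p <= q ->
  (forall s, p <= s <= q -> f s <= a) ->
  \int[mu]_(s in `[0, q]) f s - \int[mu]_(s in `[0, p]) f s <= a * (q - p).
Proof.
move=> p0 pq fa; have [-> ifpq icst <-] := increment_bounds p0 pq.
apply: (@le_Rintegral _ _ _ mu `]p, q]%classic f (cst a) (measurable_itv _) ifpq (icst _)) => s /=.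
by rewrite in_itv /= => /andP[ps sq]; rewrite fa // (ltW ps).
Qed.

Lemma primitive_increment (p q a e : R) : 0 <= p -> p <= q ->
  (forall s, p <= s <= q -> `|f s - a| <= e) ->
  `|\int[mu]_(s in `[0, q]) f s - \int[mu]_(s in `[0, p]) f s - a * (q - p)|
  <= e * (q - p).
Proof.
move=> p0 pq fa.
have h1 := @primitive_increment_ge p q (a - e) p0 pq.
have h2 := @primitive_increment_le p q (a + e) p0 pq.
rewrite ler_norml lerBrDl -mulNr -mulrDl h1 /=; last first.
  by move=> s /fa; rewrite ler_distl => /andP[].
by rewrite lerBlDl -mulrDl h2 // => s /fa; rewrite ler_distl => /andP[].
Qed.
End primitive.

(** * The Stieltjes measure of the boundary process *)

Section boundary_measure.
Context (R : realType) (F : cumulative R R) (y : R -> R).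
Hypothesis iy : forall t : R, 0 <= t ->
  lebesgue_measure.-integrable `[0, t] (fun s => (y s)%:E).
Hypothesis Fy : (\int[lebesgue_stieltjes_measure F]_(t in `[0%R, +oo[)
  (\1_[set s | (y s < 0)%R] t)%:E = 0)%E.
Let nu := lebesgue_stieltjes_measure F.

Lemma stieltjes_itv (p q : R) : p <= q -> nu `]p, q] = (F q - F p)%:E.
Proof.
move=> pq; rewrite /nu /lebesgue_stieltjes_measure.
rewrite /measure_extension measurable_mu_extE /=; last exact: is_ocitv.
by rewrite wlength_itv_bnd.
Qed.

Lemma stieltjes_boundary (A : set R) : measurable A ->
  (forall s, A s -> 0 <= s /\ y s < 0) -> nu A = 0%E.
Proof.
move=> mA Ay.
pose N := [set s | y s < 0] `&` `[0, +oo[.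
(* Measurability of the set where [y] is negative is recovered from the integrability of [y] on each
   [0, n]. *)
have mN : measurable N.
  have -> : N = \bigcup_n (`[0, n%:R] `&` y @^-1` `]-oo, 0[).
    apply/seteqP; split => [s [/= ys]|s [n _ /= []]].
      rewrite in_itv /= andbT => s0; exists (Num.bound s) => //=.
      by rewrite !in_itv /= s0 ys ltW // archi_boundP.
    by rewrite !in_itv /= => /andP[s0 _] ys; split; rewrite //= in_itv /= s0.
  apply: bigcup_measurable => n _.
  have /integrableP[/measurable_EFinP my _] := iy (ler0n R n).
  exact: my.
have : nu N = 0%E.
  rewrite -[RHS]Fy.
  transitivity (\int[nu]_(t in `[0%R, +oo[) (\1_N t)%:E)%E.
    rewrite integral_indic //; congr nu.
    by apply/seteqP; split => s //= -[].
  apply: eq_integral => s; rewrite inE => s0; congr EFin; rewrite !indicE.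
  by congr (_ %:R); congr nat_of_bool; apply/idP/idP; rewrite !inE // => -[].
move=> nuN; apply/eqP; rewrite eq_le measure_ge0 andbT -nuN.
rewrite le_measure ?inE // => s /Ay [s0 ys]; split => //=.
by rewrite in_itv /= s0.
Qed.

(* A jump of F at t > 0 would push y strictly below 0 at time t, where F does
   not increase. *)
Lemma boundary_left_continuous (C : R -> R) :
  (forall t, 0 <= t -> y t = C t - F t) -> continuous_nonneg C ->
  (forall t, 0 <= t -> y t <= 0) -> forall t e, 0 < t -> 0 < e ->
  exists2 s, 0 <= s < t & F t - F s < e.
Proof.
move=> eqC cC yle0 t e t0 e0; apply: contrapT => hn.
have jump s : 0 <= s -> s < t -> e <= F t - F s.
  move=> s0 s_t; rewrite leNgt; apply/negP => h; apply: hn; exists s => //.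
  by rewrite s0.
(* Shortly before t, F s >= C s because y s <= 0. A jump of at least e, while C varies by less than
   e, makes C t - F t negative. *)
have Yt : y t < 0.
  have [a a0 ha] := cC t (ltW t0) e e0.
  pose s := Num.max 0 (t - a / 2).
  have s0 : 0 <= s by rewrite le_max lexx.
  have s_t : s < t.
    by rewrite /s gt_max t0 ltrBlDr ltrDl divr_gt0.
  have hs : `|s - t| < a.
    rewrite distrC gtr0_norm ?subr_gt0 // ltrBlDr -ltrBlDl.
    rewrite (lt_le_trans _ (_ : t - a / 2 <= s)) //.
      by rewrite ltrD2l ltrN2 ltr_pdivrMr // mulr_natr mulr2n ltrDl.
    by rewrite le_max lexx orbT.
  have := ha s s0 hs.
  have := jump s s0 s_t; have := yle0 s s0; rewrite !eqC ?(ltW t0) //.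
  have := ler_norm (C s - C t); have := ler_norm (- (C s - C t)); rewrite normrN.
  lra.
have h0 : nu [set t] = 0%E.
  by apply: stieltjes_boundary => // s /= ->; split => //; exact: ltW.
(* These intervals decrease to the single time t, a null set of [nu], although each has mass at
   least e. *)
pose I n := `]t - t / n.+1%:R, t]%classic.
have It n : 0 <= t - t / n.+1%:R < t.
  rewrite subr_ge0 ler_pdivrMr // ler_peMr ?(ltW t0) ?ler1n //=.
  by rewrite ltrBlDr ltrDl divr_gt0.
have It1 : [set t] = \bigcap_n I n.
  apply/seteqP; split => [s /= -> n _|s hs].
    by rewrite /I /= in_itv /= lexx andbT; have /andP[] := It n.
  apply/eqP; rewrite eq_le; apply/andP; split.
    by have := hs 0%N Logic.I; rewrite /I /= in_itv /= => /andP[].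
  rewrite leNgt; apply/negP => s_t.
  have ts0 : 0 < t - s by rewrite subr_gt0.
  have := hs (Num.bound (t / (t - s))) Logic.I.
  rewrite /I /= in_itv /= => /andP[+ _]; rewrite ltrBlDr -ltrBlDl.
  rewrite ltr_pdivlMr // mulrC -ltr_pdivlMr // => h.
  have := archi_boundP (divr_ge0 (ltW t0) (ltW ts0)) => h2.
  by have := lt_trans h h2; rewrite ltr_nat ltnNge leqnSn.
have nuI n : nu (I n) = (F t - F (t - t / n.+1%:R))%:E.
  by apply: stieltjes_itv; have /andP[_ /ltW] := It n.
have cv : nu (I n) @[n --> \oo] --> nu (\bigcap_n I n).
  apply: nonincreasing_cvg_mu.
  - by rewrite [ltLHS]nuI ltry.
  - by move=> n; exact: measurable_itv.
  - by apply: bigcapT_measurable => n; exact: measurable_itv.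
  - apply/nonincreasing_seqP => n; apply/subsetPset => s.
    rewrite /I /= !in_itv /= => /andP[h ->]; rewrite andbT.
    apply: le_lt_trans h; rewrite lerD2l lerN2 ler_pM2l //.
    by rewrite lef_pV2 ?posrE // ler_nat.
move: cv; rewrite -It1 h0 => cv.
have : (e%:E <= 0)%E.
  have := cv; move/cvg_lim => <- //; apply: lime_ge; first by apply/cvg_ex; exists 0%E.
  apply: nearW => n; have /andP[In0 Int] := It n.
  by rewrite nuI lee_fin jump.
by rewrite lee_fin leNgt e0.
Qed.

End boundary_measure.

Notation primitive f t := (\int[lebesgue_measure]_(s in `[0, t]) f s).

(** What a single trajectory satisfies; the pathwise estimates below rest on this alone.
    [path_boundary] is the usable form of the Stieltjes condition: [u] can grow over a step only if
    [y1] vanishes during it. *)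
Record reflected_path (R : realType) (beta : R) (x : R * R)
    (w u y1 y2 : R -> R) : Prop := {
  path_w0 : w 0 = 0 ;
  path_w : continuous_nonneg w ;
  path_u0 : u 0 = 0 ;
  path_u : continuous_nonneg u ;
  path_u_nd : forall s t, 0 <= s -> s <= t -> u s <= u t ;
  path_y1 : continuous_nonneg y1 ;
  path_y2 : continuous_nonneg y2 ;
  path_y1_le0 : forall t, 0 <= t -> y1 t <= 0 ;
  path_y2_ge0 : forall t, 0 <= t -> 0 <= y2 t ;
  path_boundary : forall p q, 0 <= p -> p <= q -> u p < u q ->
    exists2 s, p < s <= q & y1 s = 0 ;
  path_i1 : forall t, 0 <= t ->
    lebesgue_measure.-integrable `[0, t] (fun s => (y1 s)%:E) ;
  path_i2 : forall t, 0 <= t ->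
    lebesgue_measure.-integrable `[0, t] (fun s => (y2 s)%:E) ;
  path_start : (y1 0, y2 0) = x ;
  path_eq1 : forall t, 0 <= t ->
    y1 t = x.1 + Num.sqrt 2 * w t - beta * t
           + (primitive y2 t - primitive y1 t) - u t ;
  path_eq2 : forall t, 0 <= t -> y2 t = x.2 + u t - primitive y2 t
}.

Section continuous_nonneg_algebra.
Context (R : realType).
Implicit Types f g : R -> R.

Lemma continuous_nonnegD f g : continuous_nonneg f -> continuous_nonneg g ->
  continuous_nonneg (fun t => f t + g t).
Proof.
move=> cf cg s s0 e e0; have e20 : 0 < e / 2 by rewrite divr_gt0.
have [a a0 ha] := cf s s0 _ e20; have [b b0 hb] := cg s s0 _ e20.
exists (Num.min a b); first by rewrite lt_min a0.
move=> r r0; rewrite lt_min => /andP[ra rb].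
rewrite opprD addrACA (le_lt_trans (ler_normD _ _)) // [ltRHS]splitr.
by rewrite ltrD ?ha ?hb.
Qed.

Lemma continuous_nonnegZ (c : R) f : continuous_nonneg f ->
  continuous_nonneg (fun t => c * f t).
Proof.
move=> cf s s0 e e0.
have c0 : 0 < `|c| + 1 by rewrite ltr_wpDl.
have ec0 : 0 < e / (`|c| + 1) by rewrite divr_gt0.
have [a a0 ha] := cf s s0 _ ec0; exists a => // r r0 ra.
rewrite -mulrBr normrM; have := ha r r0 ra; rewrite ltr_pdivlMr // => h.
apply: le_lt_trans h; rewrite mulrDr mulr1 [leRHS]addrC mulrC.
by rewrite lerDr.
Qed.

Lemma continuous_nonneg_id : continuous_nonneg (fun t : R => t).
Proof. by move=> s _ e e0; exists e. Qed.

Lemma continuous_nonneg_cst (c : R) : continuous_nonneg (fun _ : R => c).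
Proof. by move=> s _ e e0; exists 1 => // r _ _; rewrite subrr normr0. Qed.

Lemma continuous_nonneg_eq f g : (forall t, 0 <= t -> f t = g t) ->
  continuous_nonneg f -> continuous_nonneg g.
Proof.
move=> fg cf s s0 e e0; have [a a0 ha] := cf s s0 e e0.
by exists a => // r r0 ra; rewrite -!fg // ha.
Qed.
End continuous_nonneg_algebra.

Lemma diffusion_reflected_path (R : realType) (beta : R) (x : R * R)
    (d : measure_display) (T : measurableType d) (P : probability T R)
    (W U Y1 Y2 : R -> {RV P >-> R}) (w : T) :
  is_diffusion beta x W U Y1 Y2 ->
  reflected_path beta x (W^~ w) (U^~ w) (Y1^~ w) (Y2^~ w).
Proof.
move=> D; have BM := diffusion_brownian D.
have W0 : W 0 w = 0 by exact: brownian_at0 BM w.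
have cW : continuous_nonneg (W^~ w).
  exact/within_continuous_nonneg/(brownian_continuous BM).
have [F [FU F0 FY]] := diffusion_U_boundary D w.
have i1 := diffusion_integrable1 D w.
have i2 := diffusion_integrable2 D w.
have st := diffusion_state D w.
have und := diffusion_U_nondecreasing D w.
have start := diffusion_start D w.
have prim0 (f : R -> R) : primitive f 0 = 0.
  by rewrite set_itv1 Rintegral_set1.
have eq2 t : 0 <= t -> Y2 t w = x.2 + U t w - primitive (Y2^~ w) t.
  by move=> t0; rewrite (diffusion_eq2 D w t0) -start.
have eq1 t : 0 <= t -> Y1 t w = x.1 + Num.sqrt 2 * W t w - beta * t
           + (primitive (Y2^~ w) t - primitive (Y1^~ w) t) - U t w.
  move=> t0; rewrite {1}(diffusion_eq1 D w t0) -start; congr (_ + _ - _).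
  rewrite -RintegralB //; [|exact: i2|exact: i1].
  by apply: eq_Rintegral => s _; rewrite addrC.
(* The first equation at t = 0, where W and the integrals vanish. *)
have U0 : U 0 w = 0.
  have := eq1 0 (lexx 0); rewrite -start /= W0 !prim0 !mulr0.
  lra.
have cJ1 := primitive_continuous_nonneg i1.
have cJ2 := primitive_continuous_nonneg i2.
pose C t := x.1 + Num.sqrt 2 * W t w - beta * t
           + (primitive (Y2^~ w) t - primitive (Y1^~ w) t).
have cC : continuous_nonneg C.
  apply: (@continuous_nonneg_eq _ (fun t => ((x.1 + Num.sqrt 2 * W t w) +
    (- beta) * t) + (primitive (Y2^~ w) t + (- 1) * primitive (Y1^~ w) t))).
    by move=> t t0; rewrite /C; ring.
  by do ?[apply: continuous_nonnegD|apply: continuous_nonnegZ];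
    [exact: continuous_nonneg_cst|exact: cW|exact: continuous_nonneg_id|exact: cJ2|exact: cJ1].
have eqC t : 0 <= t -> Y1 t w = C t - U t w by exact: eq1.
have boundary p q : 0 <= p -> p <= q -> U p w < U q w ->
    exists2 s, p < s <= q & Y1 s w = 0.
  move=> p0 pq; apply: contraPP => hn; apply/negP; rewrite -leNgt.
  have Yneg s : p < s <= q -> 0 <= s /\ Y1 s w < 0.
    move=> /andP[ps sq]; have s0 := le_trans p0 (ltW ps); split => //.
    rewrite lt_neqAle (st s s0).1 andbT; apply/eqP => y0.
    by apply: hn; exists s; rewrite ?ps.
  have : lebesgue_stieltjes_measure F `]p, q] = 0%E.
    by apply: (@stieltjes_boundary R F (Y1^~ w) i1 FY).
  rewrite stieltjes_itv // !FU ?(le_trans p0) // => -[/eqP].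
  by rewrite subr_eq0 => /eqP ->.
have left t e : 0 < t -> 0 < e -> exists2 s, 0 <= s < t & U t w - U s w < e.
  move=> t0 e0.
  have [||s /andP[s0 st_] h] := @boundary_left_continuous R F (Y1^~ w) i1 FY C _ cC _ t e t0 e0.
  - by move=> r r0; rewrite eqC // FU.
  - by move=> r /st [].
  - by exists s; rewrite ?s0 // -!FU // ltW.
(* On the right this is a hypothesis; on the left, monotonicity reduces it to one earlier time with
   a small gap, provided by [left]. *)
have cU : continuous_nonneg (U^~ w).
  move=> s s0 e e0.
  have := diffusion_U_right_continuous D (w := w) s0; move/cvgrPdist_lt => /(_ e e0).
  move=> -[a /= a0 ha].
  have right r : s <= r -> `|r - s| < a -> `|U r w - U s w| < e.
    rewrite le_eqVlt => /predU1P[<- _|sr ra]; first by rewrite subrr normr0.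
    by rewrite distrC; apply: ha => //=; rewrite distrC.
  move: s0; rewrite le_eqVlt => /predU1P[s0|s0].
    by exists a => // r; rewrite s0; exact: right.
  have [q /andP[q0 qs] hq] := left s e s0 e0.
  exists (Num.min a (s - q)); first by rewrite lt_min a0 subr_gt0.
  move=> r r0; rewrite lt_min => /andP[ra rq].
  have [sr|rs] := leP s r; first exact: right.
  rewrite distrC ger0_norm ?subr_ge0 ?und ?(ltW rs) //; apply: le_lt_trans hq.
  rewrite lerD2l lerN2 und // ltW //.
  by move: rq; rewrite distrC gtr0_norm ?subr_gt0 // ltrD2l ltrN2.
split => //.
- apply: (@continuous_nonneg_eq _ (fun t => C t + (-1) * U t w)).
    by move=> t t0; rewrite eqC //; ring.
  by apply: continuous_nonnegD => //; exact: continuous_nonnegZ.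
- apply: (@continuous_nonneg_eq _ (fun t => x.2 + U t w + (-1) * primitive (Y2^~ w) t)).
    by move=> t t0; rewrite [RHS]eq2 //; ring.
  apply: continuous_nonnegD; last exact: continuous_nonnegZ.
  by apply: continuous_nonnegD => //; exact: continuous_nonneg_cst.
- by move=> t /st [].
- by move=> t /st [].
Qed.

(** After the last zero of [y1] before t, [u] is constant by [path_boundary], and the supremum of
    the zeros is a zero by continuity. The alternative s = 0 covers paths that have not met the
    boundary by time t. *)
Lemma last_boundary_time (R : realType) (beta : R) (x : R * R)
    (w u y1 y2 : R -> R) (t : R) :
  reflected_path beta x w u y1 y2 -> 0 <= t ->
  exists2 s, 0 <= s <= t & u s = u t /\ (s = 0 \/ y1 s = 0).
Proof.
move=> H t0.
pose Z := [set s | 0 <= s <= t /\ y1 s = 0].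
have ueq s : 0 <= s <= t -> (forall r, s < r <= t -> y1 r <> 0) -> u s = u t.
  move=> /andP[s0 st] hs; apply/eqP; rewrite eq_le (path_u_nd H s0 st) /=.
  rewrite leNgt; apply/negP => /(path_boundary H s0 st)[r rst yr].
  exact: hs yr.
have [[z Zz]|Z0] := pselect (Z !=set0); last first.
  exists 0; rewrite ?lexx //; split; last by left.
  apply: ueq => [|r /andP[r0 rt] yr]; first by rewrite lexx.
  by apply: Z0; exists r; split; rewrite ?(ltW r0).
have Zub : ubound Z t by move=> s [/andP[]].
have supZ : has_sup Z by split; [exists z|exists t].
have zs : z <= sup Z by apply: ub_le_sup => //; exists t.
have s0 : 0 <= sup Z by apply: le_trans zs; have [/andP[]] := Zz.
have st : sup Z <= t by apply: ge_sup => //; exists z.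
exists (sup Z); first by rewrite s0.
split; last first.
  right; apply/eqP; rewrite -normr_eq0 eq_le normr_ge0 andbT.
  apply/ler_addgt0Pl => e e0; rewrite addr0.
  have [d d0 hd] := path_y1 H s0 e0.
  have [r [/andP[r0 rt] yr] rd] := sup_adherent d0 supZ.
  have rs : r <= sup Z by apply: ub_le_sup; [exists t|split; rewrite ?r0].
  have := hd r r0; rewrite yr sub0r normrN distrC ger0_norm ?subr_ge0 // => h.
  by apply/ltW/h; rewrite ltrBlDr -ltrBlDl.
apply: ueq => [|r /andP[sr rt] yr]; first by rewrite s0.
have : r <= sup Z.
  by apply: ub_le_sup; [exists t|split; rewrite ?rt ?(le_trans s0 (ltW sr))].
by rewrite leNgt sr.
Qed.

Lemma primitive0 (R : realType) (f : R -> R) : primitive f 0 = 0.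
Proof. by rewrite set_itv1 Rintegral_set1. Qed.

Lemma sqrt2_bounds (R : realType) : 0 <= Num.sqrt (2 : R) <= 2.
Proof.
rewrite sqrtr_ge0 /= -[leRHS](ger0_norm (ler0n _ _)) -sqrtr_sqr ler_wsqrtr //.
by rewrite expr2; lra.
Qed.

(** Between the last boundary time s and t, [u] does not move and the integrals of [y2] and [- y1]
    both push [y1] up, which bounds [- y1]. Adding the two equations eliminates [u] and the
    primitive of [y2], which bounds [y2]; the second equation then bounds [u]. [K] is fixed before
    the path. *)
Lemma reflected_path_bound (R : realType) (beta : R) (x : R * R) (T : R) :
  0 <= beta -> 0 <= T -> exists2 K, 0 <= K & forall w u y1 y2 M,
  reflected_path beta x w u y1 y2 ->
  0 <= M -> (forall s, 0 <= s <= T -> `|w s| <= M) ->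
  forall t, 0 <= t <= T ->
  [/\ `|y1 t| <= K * (1 + M), `|y2 t| <= K * (1 + M), `|u t| <= K * (1 + M)
    & `|Num.sqrt 2 * w t| <= K * (1 + M)].
Proof.
move=> beta0 T0.
have [a aE] : exists a, a = `|x.1| + `|x.2| + beta * T by eexists.
have bT0 : 0 <= beta * T by rewrite mulr_ge0.
have [nx1 nx2] : 0 <= `|x.1| /\ 0 <= `|x.2| by [].
have a0 : 0 <= a by lra.
(* The 4 pays for the Brownian terms at s and at t, each at most 2 M because sqrt 2 <= 2. *)
have [k1 k1E] : exists k1, k1 = a + 4 by eexists.
have k10 : 0 <= k1 by lra.
have Tk0 : 0 <= T * k1 by rewrite mulr_ge0.
have [k2 k2E] : exists k2, k2 = a + 2 + T * k1 + k1 by eexists.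
have k20 : 0 <= k2 by lra.
have Tk20 : 0 <= T * k2 by rewrite mulr_ge0.
exists (k2 + T * k2); first by rewrite addr_ge0.
move=> w u y1 y2 M H M0 wM.
have aM : 0 <= a * M by rewrite mulr_ge0.
have TkM : 0 <= T * k1 * M by rewrite mulr_ge0.
have TkM2 : 0 <= T * k2 * M by rewrite mulr_ge0.
have k1M : 0 <= k1 * M by rewrite mulr_ge0.
have k2M : 0 <= k2 * M by rewrite mulr_ge0.
have [q0 q2] := andP (sqrt2_bounds R).
have w2 s : 0 <= s <= T -> `|Num.sqrt 2 * w s| <= 2 * M.
  move=> sT; rewrite normrM ger0_norm //.
  by apply: ler_pM => //; exact: wM.
have N1 t : 0 <= t <= T -> - y1 t <= k1 * (1 + M).
  move=> tT; have /andP[t0 tT'] := tT.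
  have [s /andP[s0 st] [us ys]] := last_boundary_time H t0.
  (* The signs of [y1] and [y2] in Omega make the drift integrals favourable, so they drop out of
     the bound on [- y1]. *)
  have ds : 0 <= (primitive y2 t - primitive y2 s) - (primitive y1 t - primitive y1 s).
    rewrite subr_ge0 (@le_trans _ _ 0) //.
      have := @primitive_increment_le _ y1 (path_i1 H) s t 0 s0 st.
      rewrite mul0r; apply => r /andP[sr _]; exact: (path_y1_le0 H (le_trans s0 sr)).
    have := @primitive_increment_ge _ y2 (path_i2 H) s t 0 s0 st.
    rewrite mul0r; apply => r /andP[sr _]; exact: (path_y2_ge0 H (le_trans s0 sr)).
  have sT : 0 <= s <= T by rewrite s0 (le_trans st).
  have := w2 s sT; have := w2 t tT; rewrite !ler_norml => /andP[l1 l2] /andP[l3 l4].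
  have ys' : - y1 s <= `|x.1|.
    case: ys => [->|->]; last by rewrite oppr0.
    by rewrite -(path_start H) /= -normrN ler_norm.
  have bts : beta * t - beta * s <= beta * T.
    rewrite -mulrBr ler_wpM2l // (le_trans _ tT') // lerBlDr lerDl //.
  have := path_eq1 H t0; have := path_eq1 H s0; rewrite us => e1 e2.
  have := k1M; rewrite k1E; lra.
have y1b t : 0 <= t <= T -> `|y1 t| <= k1 * (1 + M).
  move=> tT; rewrite ler0_norm ?N1 //; apply: (path_y1_le0 H).
  by case/andP: tT.
have prim (f : R -> R) (c t : R) :
    (forall r, 0 <= r ->
      lebesgue_measure.-integrable `[0, r] (fun s => (f s)%:E)) ->
    0 <= t <= T -> 0 <= c -> (forall s, 0 <= s <= T -> `|f s| <= c) ->
    `|primitive f t| <= T * c.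
  move=> if_ /andP[t0 tT] c0 fc.
  have := @primitive_increment _ f if_ 0 t 0 c (lexx 0) t0.
  rewrite primitive0 !subr0 mul0r subr0 => h; apply: (le_trans (h _)).
    by move=> s /andP[s0 st]; rewrite subr0 fc // s0 (le_trans st).
  by rewrite mulrC ler_wpM2r.
have y2b t : 0 <= t <= T -> `|y2 t| <= k2 * (1 + M).
  move=> tT; have /andP[t0 tT'] := tT.
  rewrite ger0_norm ?(path_y2_ge0 H) //.
  have p1 := prim y1 _ t (path_i1 H) tT _ y1b.
  have : `|primitive y1 t| <= T * (k1 * (1 + M)) by apply: p1; rewrite mulr_ge0 // addr_ge0.
  have := w2 t tT; have := N1 t tT; rewrite !ler_norml => n1 /andP[l1 l2] /andP[l3 l4].
  have := path_eq1 H t0; have := path_eq2 H t0 => e2 e1.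
  have := ler_norm x.1; have := ler_norm x.2.
  have : 0 <= beta * t by rewrite mulr_ge0.
  have : 0 <= beta * T by rewrite mulr_ge0.
  rewrite k2E; lra.
move=> t tT; have /andP[t0 tT'] := tT; split.
- have := y1b t tT; have : k1 * M <= k2 * M by rewrite ler_wpM2r //; lra.
  lra.
- by have := y2b t tT; lra.
- have u0 : 0 <= u t by rewrite -(path_u0 H); exact: (path_u_nd H).
  rewrite ger0_norm //.
  have p2 := prim y2 _ t (path_i2 H) tT _ y2b.
  have : `|primitive y2 t| <= T * (k2 * (1 + M)) by apply: p2; rewrite mulr_ge0 // addr_ge0.
  have x20 : 0 <= x.2 by rewrite -(path_start H) /= (path_y2_ge0 H).
  have := y2b t tT; rewrite !ler_norml => /andP[l1 l2] /andP[l3 l4].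
  have := path_eq2 H t0; lra.
- have := w2 t tT; have : 2 * M <= k2 * M by rewrite ler_wpM2r //; lra.
  lra.
Qed.

(** * Convergence of the Euler scheme *)

(* One step of length delta of an explicit scheme for the triple
   (Y1 + U, U, int_0^. Y2), with U updated as the running maximum of
   Y1 + U (Skorokhod reflection). *)
Fixpoint euler (R : realType) (beta delta : R) (x : R * R) (dw : nat -> R)
    (k : nat) : R * R * R :=
  if k is k'.+1 then
    let: (X, U, C) := euler beta delta x dw k' in
    let X' := X + Num.sqrt 2 * dw k' - beta * delta
              + delta * ((x.2 + U - C) - (X - U)) in
    (X', Num.max U X', C + delta * (x.2 + U - C))
  else (x.1, 0, 0).

Definition euler1 (R : realType) (beta delta : R) x dw k : R :=
  (euler beta delta x dw k).1.1 - (euler beta delta x dw k).1.2.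
Definition euler2 (R : realType) (beta delta : R) x dw k : R :=
  x.2 + (euler beta delta x dw k).1.2 - (euler beta delta x dw k).2.

(** A discrete Gronwall argument. The increments of [w] enter exactly, so one step adds to the error
    a of X twice delta (2 a + eta), from the errors in the state, and twice delta eta, from freezing
    the integrands: a' = a + delta (4 a + 4 eta). The extra eta for U is the oscillation of [y1]
    within one step; it does not accumulate, since U is updated by a maximum. *)
Lemma euler_error (R : realType) (beta : R) (x : R * R) (w u y1 y2 : R -> R)
    (T delta eta : R) (t : nat -> R) (k : nat) :
  reflected_path beta x w u y1 y2 -> 0 <= delta -> 0 <= eta ->
  (forall r s, 0 <= r <= T -> 0 <= s <= T -> `|r - s| <= delta ->
    `|y1 r - y1 s| <= eta /\ `|y2 r - y2 s| <= eta) ->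
  t 0%N = 0 -> (forall i, t i.+1 = t i + delta) -> t k <= T ->
  let: (X, U, C) := euler beta delta x (fun i => w (t i.+1) - w (t i)) k in
  let a := eta * ((1 + 4 * delta) ^+ k - 1) in
  [/\ `|X - (y1 (t k) + u (t k))| <= a, `|U - u (t k)| <= a + eta
    & `|C - primitive y2 (t k)| <= a].
Proof.
move=> H d0 eta0 osc t0 tS.
have tge i : 0 <= t i by elim: i => [|i IH]; rewrite ?t0 // tS addr_ge0.
elim: k => [|k IH] tkT /=.
  rewrite t0 expr0 subrr mulr0 (path_u0 H) primitive0 !subr0 addr0 add0r.
  by rewrite -(path_start H) /= subrr normr0.
have tkk : t k <= t k.+1 by rewrite tS lerDl.
have tkT' := le_trans tkk tkT.
move: (IH tkT').
case: (euler _ _ _ _ _) => [[X U] C] [hX hU hC].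
set a := eta * (_ ^+ k - 1) in hX hU hC *.
set a' := eta * (_ ^+ k.+1 - 1).
have a'E : a' = a + delta * (4 * a + 4 * eta) by rewrite /a' /a exprS; ring.
have a0 : 0 <= a := le_trans (normr_ge0 _) hX.
have aa' : a <= a' by rewrite a'E lerDl mulr_ge0 // addr_ge0 // mulr_ge0.
have dt : t k.+1 - t k = delta by rewrite tS addrAC subrr add0r.
have onstep s : t k <= s <= t k.+1 -> 0 <= s <= T /\ `|s - t k| <= delta /\ `|t k.+1 - s| <= delta.
  move=> /andP[s1 s2]; rewrite (le_trans (tge k) s1) (le_trans s2 tkT).
  by split => //; rewrite !ger0_norm ?subr_ge0 // -dt; split; [exact: lerB|exact: lerB].
have i1 : `|primitive y1 (t k.+1) - primitive y1 (t k) - y1 (t k) * delta| <= eta * delta.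
  rewrite -{1 2}dt; apply: (primitive_increment (path_i1 H)) => // s /onstep[sT [sd _]].
  by apply: (osc _ _ sT _ sd).1; rewrite tge.
have i2 : `|primitive y2 (t k.+1) - primitive y2 (t k) - y2 (t k) * delta| <= eta * delta.
  rewrite -{1 2}dt; apply: (primitive_increment (path_i2 H)) => // s /onstep[sT [sd _]].
  by apply: (osc _ _ sT _ sd).2; rewrite tge.
have eqk := path_eq1 H (tge k); have eqk1 := path_eq1 H (tge k.+1).
have eq2k := path_eq2 H (tge k).
have de1 : `|delta * ((X - U) - y1 (t k))| <= delta * (2 * a + eta).
  rewrite normrM ger0_norm // ler_wpM2l //.
  rewrite (_ : X - U - y1 (t k) = (X - (y1 (t k) + u (t k))) - (U - u (t k))); last by ring.
  by rewrite (le_trans (ler_normB _ _)) //; lra.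
have de2 : `|delta * ((x.2 + U - C) - y2 (t k))| <= delta * (2 * a + eta).
  rewrite normrM ger0_norm // ler_wpM2l // eq2k.
  rewrite (_ : x.2 + U - C - _ = (U - u (t k)) - (C - primitive y2 (t k))); last by ring.
  by rewrite (le_trans (ler_normB _ _)) //; lra.
set X' := X + _ - _ + _.
have hX' : `|X' - (y1 (t k.+1) + u (t k.+1))| <= a'.
  have X'E : X' - (y1 (t k.+1) + u (t k.+1)) =
    (X - (y1 (t k) + u (t k))) + delta * ((x.2 + U - C) - y2 (t k))
    - delta * ((X - U) - y1 (t k))
    - (primitive y2 (t k.+1) - primitive y2 (t k) - y2 (t k) * delta)
    + (primitive y1 (t k.+1) - primitive y1 (t k) - y1 (t k) * delta).
    by rewrite /X' eqk1 {1}eqk tS; ring.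
  rewrite X'E a'E; move: hX de1 de2 i1 i2.
  clearbody a; clear; rewrite !ler_norml => /andP[? ?] /andP[? ?] /andP[? ?] /andP[? ?] /andP[? ?].
  apply/andP; split; lra.
split => //.
- have y1n : y1 (t k.+1) <= 0 by exact: (path_y1_le0 H).
  have und := path_u_nd H (tge k) tkk.
  (* If [u] is constant on the step, X' exceeds it by at most a' because [y1] <= 0. If [u] grows,
     [y1] vanishes during the step, hence is at least - eta at its end, and X' is at least u - eta -
     a'. *)
  have [uE|uN] := eqVneq (u (t k.+1)) (u (t k)).
    move: hU hX' y1n aa' eta0; rewrite uE; clearbody a a' X'; clear.
    rewrite !ler_norml => /andP[h1 h2] /andP[h3 h4] *.
    by case: (leP U X') => ?; apply/andP; split; lra.
  have ult : u (t k) < u (t k.+1) by rewrite lt_neqAle eq_sym uN.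
  have [s /andP[s1 s2] ys] := path_boundary H (tge k) tkk ult.
  have /onstep[sT [_ sd]] : t k <= s <= t k.+1 by rewrite s2 ltW.
  have tk1T : 0 <= t k.+1 <= T by rewrite tge.
  have [+ _] := osc _ _ tk1T sT sd; rewrite ys subr0 => hy.
  move: hU hX' hy y1n und aa' eta0; clearbody a a' X'; clear.
  rewrite !ler_norml => /andP[h1 h2] /andP[h3 h4] /andP[h5 h6] *.
  by case: (leP U X') => ?; apply/andP; split; lra.
- have -> : C + delta * (x.2 + U - C) - primitive y2 (t k.+1) =
    (C - primitive y2 (t k)) + delta * ((x.2 + U - C) - y2 (t k))
    - (primitive y2 (t k.+1) - primitive y2 (t k) - y2 (t k) * delta) by ring.
  rewrite a'E; have : 0 <= delta * a by rewrite mulr_ge0.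
  have : 0 <= delta * eta by rewrite mulr_ge0.
  move: hC de2 i2; clearbody a; clear.
  rewrite !ler_norml => /andP[? ?] /andP[? ?] /andP[? ?] *; apply/andP; split; lra.
Qed.

Lemma euler_cvg (R : realType) (beta : R) (x : R * R) (w u y1 y2 : R -> R)
    (s : R) :
  reflected_path beta x w u y1 y2 -> 0 <= s ->
  let t n i := s * i%:R / n.+1%:R : R in
  let dw n i := w (t n i.+1) - w (t n i) in
  (fun n => euler1 beta (s / n.+1%:R) x (dw n) n.+1) @ \oo --> y1 s /\
  (fun n => euler2 beta (s / n.+1%:R) x (dw n) n.+1) @ \oo --> y2 s.
Proof.
move=> H s0 t dw.
suff cv e : 0 < e -> \forall n \near \oo,
    `|y1 s - euler1 beta (s / n.+1%:R) x (dw n) n.+1| < e /\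
    `|y2 s - euler2 beta (s / n.+1%:R) x (dw n) n.+1| < e.
  by split; apply/cvgrPdist_lt => e e0; apply: filterS (cv e e0) => n [].
(* [E] bounds (1 + 4 s / (n + 1))^(n + 1). With eta = e / (3 E) the errors of X, U and C are each at
   most e / 3, and each of [euler1] and [euler2] involves two of them. *)
move=> e0; pose E := expR (4 * s).
have E1 : 0 < E by exact: expR_gt0.
pose eta := e / (3 * E).
have eta0 : 0 < eta by rewrite divr_gt0 // mulr_gt0.
have [d1 d10 h1] := continuous_nonneg_uniform s (path_y1 H) eta0.
have [d2 d20 h2] := continuous_nonneg_uniform s (path_y2 H) eta0.
pose d := Num.min d1 d2; have d0 : 0 < d by rewrite lt_min d10.
exists (Num.bound (s / d)) => // n /= nd.
set delta := s / n.+1%:R.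
have delta0 : 0 <= delta by rewrite divr_ge0.
have deltad : delta < d.
  rewrite ltr_pdivrMr // mulrC -ltr_pdivrMr //.
  apply: (lt_le_trans (archi_boundP _)); first by rewrite divr_ge0 // ltW.
  by rewrite ler_nat (leq_trans nd).
have tE : t n n.+1 = s by rewrite /t mulfK // pnatr_eq0.
have tS i : t n i.+1 = t n i + delta by rewrite /t -(natr1 i) mulrDr mulr1 mulrDl.
have osc r r' : 0 <= r <= s -> 0 <= r' <= s -> `|r - r'| <= delta ->
    `|y1 r - y1 r'| <= eta /\ `|y2 r - y2 r'| <= eta.
  move=> hr hr' /le_lt_trans/(_ deltad); rewrite lt_min => /andP[l1 l2].
  by split; apply/ltW; [exact: h1|exact: h2].
have t00 : t n 0%N = 0 by rewrite /t mulr0 mul0r.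
have tT : t n n.+1 <= s by rewrite tE.
have := euler_error H delta0 (ltW eta0) osc t00 tS tT.
rewrite tE /euler1 /euler2 -/(dw n).
case: (euler _ _ _ _ _) => [[X U] C] /= [hX hU hC].
have aE : eta * ((1 + 4 * delta) ^+ n.+1 - 1) + eta <= e / 3.
  have -> : eta * ((1 + 4 * delta) ^+ n.+1 - 1) + eta = eta * (1 + 4 * delta) ^+ n.+1 by ring.
  have -> : e / 3 = eta * E by rewrite /eta; field; rewrite gt_eqF.
  rewrite ler_wpM2l ?(ltW eta0) //.
  have -> : E = expR (4 * delta) ^+ n.+1.
    by rewrite -expRM_natr -mulrA /delta mulfVK // pnatr_eq0.
  by rewrite lerXn2r ?nnegrE ?expR_ge0 ?addr_ge0 ?mulr_ge0 // expR_ge1Dx.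
have eq2 := path_eq2 H s0.
move: hX hU hC aE; set a := eta * _; clearbody a.
move: eta0 e0 eq2; clear; rewrite !ler_norml !ltr_norml.
move=> eta0 e0 -> /andP[? ?] /andP[? ?] /andP[? ?] ?.
by split; lra.
Qed.

(** * Exponentials along a path *)

Lemma continuous_nonneg_comp (R : realType) (F f : R -> R) :
  continuous F -> continuous_nonneg f -> continuous_nonneg (F \o f).
Proof.
move=> cF cf s s0 e e0.
have /cvgrPdist_lt/(_ e e0)[a /= a0 ha] := cF (f s).
have [d d0 hd] := cf s s0 a a0; exists d => // r r0 rd.
by rewrite distrC; apply: ha; rewrite /= distrC hd.
Qed.

Lemma continuous_nonnegM (R : realType) (f g : R -> R) :
  continuous_nonneg f -> continuous_nonneg g ->
  continuous_nonneg (fun t => f t * g t).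
Proof.
move=> cf cg.
have cs : continuous (fun x : R => x ^+ 2) by exact: sqr_continuous.
apply: (@continuous_nonneg_eq _ (fun t => 4^-1 * (f t + g t) ^+ 2 +
    (- 4^-1) * (f t + (- 1) * g t) ^+ 2)); first by move=> t _; field.
apply: continuous_nonnegD; apply: continuous_nonnegZ.
  by apply: (continuous_nonneg_comp cs); exact: continuous_nonnegD.
apply: (continuous_nonneg_comp cs); apply: continuous_nonnegD => //.
exact: continuous_nonnegZ.
Qed.

Lemma continuous_nonneg_integrable (R : realType) (f : R -> R) (t : R) :
  continuous_nonneg f ->
  lebesgue_measure.-integrable `[0, t] (fun s => (f s)%:E).
Proof.
move=> /within_continuous_nonneg cf.
apply: continuous_compact_integrable; first exact: segment_compact.
apply: continuous_subspaceW cf => s /=; rewrite !in_itv /=.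
by move=> /andP[->].
Qed.

Lemma expR_lipschitz (R : realType) (m u v : R) : u <= m -> v <= m ->
  `|expR u - expR v| <= `|u - v| * expR m.
Proof.
wlog uv : u v / v <= u.
  move=> h um vm; have [vu|/ltW uv] := leP v u; first exact: h.
  by rewrite distrC [`|u - v|]distrC h.
move=> um vm; rewrite !ger0_norm ?subr_ge0 ?ler_expR //.
have -> : expR v = expR u * expR (v - u) by rewrite -expRD subrKC.
have h1 := expR_ge1Dx (v - u).
apply: (@le_trans _ _ ((u - v) * expR u)); last first.
  by rewrite ler_wpM2l ?subr_ge0 ?ler_expR.
have := ler_wpM2l (expR_ge0 u) h1; lra.
Qed.

(** Only e^z >= 1 + z, at z and at - z, is used, at the price of the usual factor 1/2. *)
Lemma expR_second_order (R : realType) (z : R) :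
  `|expR z - 1 - z| <= z ^+ 2 * expR `|z|.
Proof.
have h1 := expR_ge1Dx z; have h2 := expR_ge1Dx (- z).
have h3 := expRxMexpNx_1 z.
rewrite ger0_norm; last by lra.
have [z0|z0] := leP 0 z.
  have h4 : expR z - 1 <= z * expR z.
    by have := ler_wpM2l (expR_ge0 z) h2; lra.
  by have := ler_wpM2l z0 h4; rewrite (ger0_norm z0) expr2; lra.
have z0' : 0 <= - z by lra.
have h5 : expR z - 1 - z <= z ^+ 2.
  have h6 : expR z * (1 - z) <= 1 by have := ler_wpM2l (expR_ge0 z) h2; lra.
  have := ler_wpM2l z0' h1; rewrite expr2; lra.
apply: (le_trans h5); rewrite ler_peMr ?sqr_ge0 //.
by rewrite -[leLHS]expR0 ler_expR.
Qed.

Definition expo (R : realType) (k y : R * R) : R :=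
  expR (k.1 * y.1 + k.2 * y.2).

Definition expo_gen (R : realType) (beta : R) (k y : R * R) : R :=
  expo k y * (k.1 * (- y.1 + y.2 - beta) - k.2 * y.2 + k.1 ^+ 2).

(* The increment of exp (a Y1 + b Y2) over [p, q], with the Brownian factor
   replaced by its mean. *)
Definition expo_step (R : realType) (k : R * R) (w y1 y2 : R -> R) (p q : R) : R :=
  expo k (y1 q, y2 q) - expo k (y1 p, y2 p)
  - expo k (y1 p, y2 p) * (expR (k.1 * (Num.sqrt 2 * (w q - w p)))
                           - expR (k.1 ^+ 2 * (q - p))).

Section step.
Context (R : realType) (beta c : R) (k : R * R).
Hypotheses (c1 : 1 <= c) (bc : `|beta| <= c) (k1c : `|k.1| <= c) (k2c : `|k.2| <= c).

Lemma expo_exponent_bound (L : R) (y : R * R) : `|y.1| <= L -> `|y.2| <= L ->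
  `|k.1 * y.1 + k.2 * y.2| <= 2 * c * L.
Proof.
move=> h1 h2; rewrite (le_trans (ler_normD _ _)) // !normrM.
have -> : 2 * c * L = c * L + c * L by ring.
by apply: lerD; apply: ler_pM.
Qed.

Lemma drift_bound (L : R) (y : R * R) : `|y.1| <= L -> `|y.2| <= L ->
  `|k.1 * (- y.1 + y.2 - beta) - k.2 * y.2 + k.1 ^+ 2| <= 3 * c * L + 2 * c ^+ 2.
Proof.
move=> h1 h2.
have a1 : `|k.1 * y.1| <= c * L by rewrite normrM ler_pM.
have a2 : `|k.1 * y.2| <= c * L by rewrite normrM ler_pM.
have a3 : `|k.2 * y.2| <= c * L by rewrite normrM ler_pM.
have a4 : `|k.1 * beta| <= c ^+ 2 by rewrite normrM expr2 ler_pM.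
have a5 : `|k.1 ^+ 2| <= c ^+ 2 by rewrite normrX !expr2 ler_pM.
have -> : k.1 * (- y.1 + y.2 - beta) - k.2 * y.2 + k.1 ^+ 2 =
  - (k.1 * y.1) + k.1 * y.2 - k.1 * beta - k.2 * y.2 + k.1 ^+ 2 by ring.
move: a1 a2 a3 a4 a5; clear; rewrite !ler_norml.
by move=> /andP[? ?] /andP[? ?] /andP[? ?] /andP[? ?] /andP[? ?]; apply/andP; split; lra.
Qed.

Lemma expo_gen_bound (L : R) (y : R * R) : `|y.1| <= L -> `|y.2| <= L ->
  `|expo_gen beta k y| <= expR (2 * c * L) * (3 * c * L + 2 * c ^+ 2).
Proof.
move=> h1 h2; rewrite /expo_gen normrM ler_pM ?drift_bound //.
rewrite ger0_norm ?expR_ge0 // /expo ler_expR.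
by rewrite (le_trans (ler_norm _)) // expo_exponent_bound.
Qed.

Lemma expo_gen_lipschitz (L eta : R) (y z : R * R) :
  `|y.1| <= L -> `|y.2| <= L -> `|z.1| <= L -> `|z.2| <= L ->
  `|y.1 - z.1| <= eta -> `|y.2 - z.2| <= eta ->
  `|expo_gen beta k y - expo_gen beta k z| <=
  expR (2 * c * L) * eta * (2 * c * (3 * c * L + 2 * c ^+ 2) + 3 * c).
Proof.
move=> y1 y2 z1 z2 d1 d2; rewrite /expo_gen.
set ly := k.1 * _ - _ + _; set lz := k.1 * (- z.1 + _ - _) - _ + _.
have -> : expo k y * ly - expo k z * lz =
  (expo k y - expo k z) * ly + expo k z * (ly - lz) by ring.
have eE v : `|v.1| <= L -> `|v.2| <= L -> k.1 * v.1 + k.2 * v.2 <= 2 * c * L.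
  by move=> ? ?; rewrite (le_trans (ler_norm _)) // expo_exponent_bound.
have b1 : `|expo k y - expo k z| <= 2 * c * eta * expR (2 * c * L).
  apply: (le_trans (expR_lipschitz (eE y y1 y2) (eE z z1 z2))).
  rewrite ler_wpM2r ?expR_ge0 //.
  rewrite (_ : _ - _ = k.1 * (y.1 - z.1, y.2 - z.2).1 + k.2 * (y.1 - z.1, y.2 - z.2).2).
    exact: expo_exponent_bound.
  by rewrite /=; ring.
have b2 : `|ly - lz| <= 3 * c * eta.
  have -> : ly - lz = - (k.1 * (y.1 - z.1)) + k.1 * (y.2 - z.2) - k.2 * (y.2 - z.2).
    by rewrite /ly /lz; ring.
  have a1 : `|k.1 * (y.1 - z.1)| <= c * eta by rewrite normrM ler_pM.
  have a2 : `|k.1 * (y.2 - z.2)| <= c * eta by rewrite normrM ler_pM.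
  have a3 : `|k.2 * (y.2 - z.2)| <= c * eta by rewrite normrM ler_pM.
  move: a1 a2 a3; clear; rewrite !ler_norml.
  by move=> /andP[? ?] /andP[? ?] /andP[? ?]; apply/andP; split; lra.
have b3 := drift_bound y1 y2; rewrite -/ly in b3.
have b4 : `|expo k z| <= expR (2 * c * L).
  by rewrite ger0_norm ?expR_ge0 // ler_expR eE.
have := ler_pM (normr_ge0 _) (normr_ge0 _) b1 b3.
have := ler_pM (normr_ge0 _) (normr_ge0 _) b4 b2.
rewrite -!normrM => h1 h2; rewrite (le_trans (ler_normD _ _)) //; lra.
Qed.

(** With a = [k.1] and b = [k.2], the exponent changes by a times the Brownian increment, plus b - a
    times the increment of [u], plus a drift of order q - p. In [expo_step] the Brownian factor is
    replaced by e^(a^2 (q - p)), which supplies the second-order term of [expo_gen]. Every remainder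
    is eta times an increment of [u] or of time, so that sums over a grid telescope. The boundary
    term carries e^(b y2), the value at y1 = 0, where different exponents can cancel. *)
Lemma expo_step_estimate (x : R * R) (w u y1 y2 : R -> R) (L eta p q : R) :
  reflected_path beta x w u y1 y2 ->
  0 <= p -> p <= q -> q - p <= eta -> q - p <= L ->
  (forall s, p <= s <= q -> [/\ `|y1 s| <= L, `|y2 s| <= L & `|Num.sqrt 2 * w s| <= L]) ->
  (forall r s, p <= r <= q -> p <= s <= q ->
     [/\ `|y1 r - y1 s| <= eta, `|y2 r - y2 s| <= eta
       & `|Num.sqrt 2 * w r - Num.sqrt 2 * w s| <= eta]) ->
  `|expo_step k w y1 y2 p q
    - (primitive (fun s => expo_gen beta k (y1 s, y2 s)) q
       - primitive (fun s => expo_gen beta k (y1 s, y2 s)) p)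
    - (k.2 - k.1) * expR (k.2 * y2 p) * (u q - u p)|
  <= expR (10 * c ^+ 2 * L) * eta
     * (10 * c ^+ 2 * (u q - u p)
        + (6 * c * (3 * c * L + 2 * c ^+ 2) + 6 * c + c ^+ 4) * (q - p)).
Proof.
move=> H p0 pq dE dL bd osc.
have q0 := le_trans p0 pq.
have pp : p <= p <= q by rewrite lexx.
have qq : p <= q <= q by rewrite lexx pq.
have [b1p b2p bwp] := bd p pp; have [b1q b2q bwq] := bd q qq.
have [os1 os2 osw] := osc q p qq pp.
have L0 : 0 <= L := le_trans (normr_ge0 _) b1p.
have eta0 : 0 <= eta := le_trans (normr_ge0 _) os1.
have c0 : 0 <= c by apply: le_trans c1.
have cc : c <= c ^+ 2 by rewrite expr2 ler_peMr.
have cL : c * L <= c ^+ 2 * L by rewrite ler_wpM2r.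
have cL0 : 0 <= c * L by rewrite mulr_ge0.
have du0 : 0 <= u q - u p by rewrite subr_ge0 (path_u_nd H).
have d0 : 0 <= q - p by rewrite subr_ge0.
set du := u q - u p in du0 *; set del := q - p in dE dL d0 *.
(* The largest exponents are 4 c L in [e'] and 6 c L in [Delta]; the square of c leaves room for a^2
   (q - p) <= c^2 L. *)
set G := expR (10 * c ^+ 2 * L).
have [a aE] : exists a, a = k.1 by eexists.
have [b bE] : exists b, b = k.2 by eexists.
have ac : `|a| <= c by rewrite aE.
have bc' : `|b| <= c by rewrite bE.
pose ws := Num.sqrt 2 * (w q - w p).
have wsE : ws = Num.sqrt 2 * w q - Num.sqrt 2 * w p by rewrite /ws mulrBr.
set e := expo k (y1 p, y2 p).
pose e' := expR (a * y1 p + b * y2 p + a * ws).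
pose D1 := primitive y1 q - primitive y1 p.
pose D2 := primitive y2 q - primitive y2 p.
pose dl := a * (D2 - D1 - beta * del) - b * D2.
pose Delta := (b - a) * du + dl.
have Delta_E : Delta = a * (y1 q - y1 p) + b * (y2 q - y2 p) - a * ws.
  rewrite (path_eq1 H p0) (path_eq1 H q0) (path_eq2 H p0) (path_eq2 H q0).
  rewrite /Delta /dl /D1 /D2 /du /del wsE.
  by ring.
pose lp := a * (- y1 p + y2 p - beta) - b * y2 p.
pose Ig := primitive (fun s => expo_gen beta k (y1 s, y2 s)) q
       - primitive (fun s => expo_gen beta k (y1 s, y2 s)) p.
pose Lam := 3 * c * L + 2 * c ^+ 2.
have Lam0 : 0 <= Lam by rewrite addr_ge0 ?mulr_ge0 ?exprn_ge0.
have eE : e = expR (a * y1 p + b * y2 p) by rewrite /e /expo aE bE.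
have stepE : expo_step k w y1 y2 p q = e' * expR Delta - e' + e * (expR (a ^+ 2 * del) - 1).
  rewrite /expo_step -/e -aE -/ws -/del /expo -aE -bE /=.
  have -> : a * y1 q + b * y2 q = (a * y1 p + b * y2 p + a * ws) + Delta.
    by rewrite Delta_E; ring.
  by rewrite expRD -/e' /e' expRD -eE; ring.
(* Six remainders, bounded by [T1] to [T6]: curvature of exp in [Delta], boundary term away from y1
   = 0, Brownian factor against drift, freezing of the drift at p, curvature of e^(a^2 del), Riemann
   error of the time integral. *)
have -> : expo_step k w y1 y2 p q - Ig - (k.2 - k.1) * expR (k.2 * y2 p) * du =
    e' * (expR Delta - 1 - Delta) + (b - a) * (e' - expR (b * y2 p)) * du
    + (e' - e) * dl + e * (dl - lp * del)
    + e * (expR (a ^+ 2 * del) - 1 - a ^+ 2 * del)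
    - (Ig - e * (lp + a ^+ 2) * del).
  by rewrite stepE -aE -bE /Delta; ring.
have [G0 e0 e'0] : [/\ 0 < G, 0 <= e & 0 <= e'] by rewrite /G /e /e' !expR_ge0 expR_gt0.
have aw : `|a * ws| <= 2 * c * L.
  have h1 : `|a * (Num.sqrt 2 * w q)| <= c * L by rewrite normrM ler_pM.
  have h2 : `|a * (Num.sqrt 2 * w p)| <= c * L by rewrite normrM ler_pM.
  rewrite wsE mulrBr (le_trans (ler_normB _ _)) //.
  have -> : 2 * c * L = c * L + c * L by ring.
  exact: lerD.
have awe : `|a * ws| <= c * eta by rewrite wsE normrM ler_pM.
have ep : `|a * y1 p + b * y2 p| <= 2 * c * L.
  by rewrite aE bE; exact: (@expo_exponent_bound L (y1 p, y2 p)).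
have eq_ : `|a * y1 q + b * y2 q| <= 2 * c * L.
  by rewrite aE bE; exact: (@expo_exponent_bound L (y1 q, y2 q)).
have Dbig : `|Delta| <= 6 * c * L.
  have -> : Delta = (a * y1 q + b * y2 q) - (a * y1 p + b * y2 p) - a * ws.
    by rewrite Delta_E; ring.
  move: aw ep eq_; clear; rewrite !ler_norml.
  by move=> /andP[? ?] /andP[? ?] /andP[? ?]; apply/andP; split; lra.
have Dsmall : `|Delta| <= 3 * c * eta.
  have h1 : `|a * (y1 q - y1 p)| <= c * eta by rewrite normrM ler_pM.
  have h2 : `|b * (y2 q - y2 p)| <= c * eta by rewrite normrM ler_pM.
  rewrite Delta_E; move: awe h1 h2; clear; rewrite !ler_norml.
  by move=> /andP[? ?] /andP[? ?] /andP[? ?]; apply/andP; split; lra.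
have D1b : `|D1| <= L * del.
  have := @primitive_increment _ y1 (path_i1 H) p q 0 L p0 pq.
  by rewrite mul0r subr0; apply => s /bd[h _ _]; rewrite subr0.
have D2b : `|D2| <= L * del.
  have := @primitive_increment _ y2 (path_i2 H) p q 0 L p0 pq.
  by rewrite mul0r subr0; apply => s /bd[_ h _]; rewrite subr0.
have Ld0 : 0 <= L * del by rewrite mulr_ge0.
have dlb : `|dl| <= Lam * del.
  have h1 : `|a * D1| <= c * (L * del) by rewrite normrM ler_pM.
  have h2 : `|a * D2| <= c * (L * del) by rewrite normrM ler_pM.
  have h3 : `|b * D2| <= c * (L * del) by rewrite normrM ler_pM.
  have h4 : `|a * beta * del| <= c ^+ 2 * del.
    by rewrite normrM ler_pM // ?normrM ?expr2 ?ler_pM // ger0_norm.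
  have c20 : 0 <= c ^+ 2 * del by rewrite mulr_ge0 ?exprn_ge0.
  rewrite /dl /Lam; move: h1 h2 h3 h4 c20; clear; rewrite !ler_norml.
  move=> /andP[? ?] /andP[? ?] /andP[? ?] /andP[? ?] ?; apply/andP; split; lra.
have dlb' : `|dl - lp * del| <= 3 * c * eta * del.
  have i1 : `|D1 - y1 p * del| <= eta * del.
    apply: (primitive_increment (path_i1 H)) => // s sT.
    by have [] := osc s p sT pp.
  have i2 : `|D2 - y2 p * del| <= eta * del.
    apply: (primitive_increment (path_i2 H)) => // s sT.
    by have [] := osc s p sT pp.
  have h1 : `|a * (D1 - y1 p * del)| <= c * (eta * del) by rewrite normrM ler_pM.
  have h2 : `|a * (D2 - y2 p * del)| <= c * (eta * del) by rewrite normrM ler_pM.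
  have h3 : `|b * (D2 - y2 p * del)| <= c * (eta * del) by rewrite normrM ler_pM.
  rewrite /dl /lp; move: h1 h2 h3; clear; rewrite !ler_norml.
  by move=> /andP[? ?] /andP[? ?] /andP[? ?]; apply/andP; split; lra.
have Dmed : `|Delta| <= 2 * c * du + Lam * del.
  have h1 : `|(b - a) * du| <= 2 * c * du.
    rewrite normrM (ger0_norm du0) ler_wpM2r // (le_trans (ler_normB _ _)) //.
    by rewrite mulr_natl mulr2n lerD.
  by rewrite /Delta (le_trans (ler_normD _ _)) // lerD.
have Gle z : z <= 10 * c * L -> expR z <= G.
  move=> h; rewrite ler_expR (le_trans h) // -mulrA -[leRHS]mulrA.
  by rewrite ler_wpM2l.
have e'G : e' <= G.
  by apply: Gle; move: aw ep cL0; clear; rewrite !ler_norml => /andP[? ?] /andP[? ?] ?; lra.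
have eG : e <= G.
  by rewrite eE; apply: Gle; move: ep cL0; clear; rewrite ler_norml => /andP[? ?] ?; lra.
have T1 : `|e' * (expR Delta - 1 - Delta)| <= G * (3 * c * eta * (2 * c * du + Lam * del)).
  rewrite normrM (ger0_norm e'0).
  apply: (@le_trans _ _ (e' * (Delta ^+ 2 * expR `|Delta|))).
    by rewrite ler_wpM2l // expR_second_order.
  rewrite mulrCA mulrC ler_pM //.
  - by rewrite mulr_ge0 ?expR_ge0.
  - by rewrite sqr_ge0.
  - rewrite /e' -expRD; apply: Gle.
    move: aw ep Dbig; move: `|Delta| => m; clear.
    by rewrite !ler_norml => /andP[? ?] /andP[? ?] ?; lra.
  - by rewrite -[_ ^+ 2]ger0_norm ?sqr_ge0 // normrX expr2 ler_pM.
(* If [u] grows, [y1] vanishes within the step, so |y1 p| <= eta and [e'] is close to e^(b y2 p);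
   otherwise the term is 0. *)
have T2 : `|(b - a) * (e' - expR (b * y2 p)) * du| <= G * (4 * c ^+ 2 * eta * du).
  move: du0; rewrite le_eqVlt => /predU1P[<-|dup]; first by rewrite !mulr0 normr0.
  have ult : u p < u q by rewrite -subr_gt0.
  have [s /andP[ps sq] ys] := path_boundary H p0 pq ult.
  have sT : p <= s <= q by rewrite sq ltW.
  have [] := osc p s pp sT; rewrite ys subr0 => y1p _ _.
  have h1 : `|e' - expR (b * y2 p)| <= 2 * c * eta * G.
    have hb : b * y2 p <= 10 * c ^+ 2 * L.
      have : `|b * y2 p| <= c * L by rewrite normrM ler_pM.
      by move: cL0 cL; clear; rewrite ler_norml => ? ? /andP[? ?]; lra.
    have he : a * y1 p + b * y2 p + a * ws <= 10 * c ^+ 2 * L.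
      by move: aw ep cL0 cL; clear; rewrite !ler_norml => /andP[? ?] /andP[? ?] ? ?; lra.
    apply: (le_trans (expR_lipschitz he hb)); rewrite ler_wpM2r ?expR_ge0 //.
    have h2 : `|a * y1 p| <= c * eta by rewrite normrM ler_pM.
    have -> : a * y1 p + b * y2 p + a * ws - b * y2 p = a * y1 p + a * ws by ring.
    by move: h2 awe; clear; rewrite !ler_norml => /andP[? ?] /andP[? ?]; apply/andP; split; lra.
  have h2 : `|b - a| <= 2 * c.
    by rewrite (le_trans (ler_normB _ _)) // mulr_natl mulr2n lerD.
  rewrite !normrM (gtr0_norm dup).
  have -> : G * (4 * c ^+ 2 * eta * du) = (2 * c) * (2 * c * eta * G) * du by ring.
  by rewrite ler_wpM2r ?(ltW dup) // ler_pM.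
have T3 : `|(e' - e) * dl| <= G * (c * eta * (Lam * del)).
  have h1 : `|e' - e| <= c * eta * G.
    have he : a * y1 p + b * y2 p + a * ws <= 10 * c ^+ 2 * L.
      by move: aw ep cL0 cL; clear; rewrite !ler_norml => /andP[? ?] /andP[? ?] ? ?; lra.
    have he2 : a * y1 p + b * y2 p <= 10 * c ^+ 2 * L.
      by move: ep cL0 cL; clear; rewrite !ler_norml => /andP[? ?] ? ?; lra.
    rewrite eE; apply: (le_trans (expR_lipschitz he he2)).
    by rewrite ler_wpM2r ?expR_ge0 // addrAC subrr add0r.
  rewrite normrM mulrA [G * _]mulrC; exact: ler_pM.
have T4 : `|e * (dl - lp * del)| <= G * (3 * c * eta * del).
  by rewrite normrM (ger0_norm e0) ler_pM.
have a2c : a ^+ 2 <= c ^+ 2.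
  by rewrite -[_ ^+ 2]ger0_norm ?sqr_ge0 // normrX !expr2 ler_pM.
have T5 : `|e * (expR (a ^+ 2 * del) - 1 - a ^+ 2 * del)| <= G * (c ^+ 4 * eta * del).
  rewrite normrM (ger0_norm e0).
  apply: (@le_trans _ _ (e * ((a ^+ 2 * del) ^+ 2 * expR `|a ^+ 2 * del|))).
    by rewrite ler_wpM2l // expR_second_order.
  have ad0 : 0 <= a ^+ 2 * del by rewrite mulr_ge0 ?sqr_ge0.
  rewrite mulrCA mulrC (ger0_norm ad0) ler_pM //.
  - by rewrite mulr_ge0 ?expR_ge0.
  - by rewrite sqr_ge0.
  - rewrite eE -expRD ler_expR.
    have : a ^+ 2 * del <= c ^+ 2 * L by rewrite ler_pM ?sqr_ge0.
    by move: ep cL0 cL; clear; rewrite !ler_norml => /andP[? ?] ? ? ?; lra.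
  - have -> : c ^+ 4 * eta * del = (c ^+ 2 * eta) * (c ^+ 2 * del) by ring.
    rewrite [(_ * del) ^+ 2]expr2; apply: ler_pM => //.
      by apply: ler_pM; rewrite ?sqr_ge0.
    by rewrite ler_wpM2r.
have T6 : `|Ig - e * (lp + a ^+ 2) * del| <= G * (eta * (2 * c * Lam + 3 * c) * del).
  have cg : continuous_nonneg (fun s => expo_gen beta k (y1 s, y2 s)).
    have cid1 := path_y1 H; have cid2 := path_y2 H.
    rewrite /expo_gen /expo /=; apply: continuous_nonnegM.
      apply: (@continuous_nonneg_comp _ expR); first exact: continuous_expR.
      by apply: continuous_nonnegD; exact: continuous_nonnegZ.
    apply: (@continuous_nonneg_eq _ (fun s => (k.1 * ((-1) * y1 s + y2 s) + (- k.2) * y2 s)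
      + (k.1 ^+ 2 - k.1 * beta))); first by move=> s _; ring.
    apply: continuous_nonnegD; last exact: continuous_nonneg_cst.
    by do ?[apply: continuous_nonnegD|apply: continuous_nonnegZ].
  have ig t : 0 <= t -> lebesgue_measure.-integrable `[0, t]
      (fun s => (expo_gen beta k (y1 s, y2 s))%:E).
    by move=> _; exact: continuous_nonneg_integrable.
  have gp : e * (lp + a ^+ 2) = expo_gen beta k (y1 p, y2 p).
    by rewrite /expo_gen -/e /lp aE bE.
  rewrite gp mulrA; apply: (primitive_increment ig) => // s sT.
  have [h1 h2 _] := bd s sT; have [h3 h4 _] := osc s p sT pp.
  apply: (le_trans (@expo_gen_lipschitz L eta (y1 s, y2 s) (y1 p, y2 p) h1 h2 b1p b2p h3 h4)).
  rewrite -/Lam !mulrA -[leLHS]mulrA -[leRHS]mulrA ler_wpM2r //.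
    by rewrite mulr_ge0 // addr_ge0 // !mulr_ge0.
  by apply: Gle; rewrite -!mulrA ler_wpM2r // ler_nat.
have -> : G * eta * (10 * c ^+ 2 * du + (6 * c * Lam + 6 * c + c ^+ 4) * del) =
   G * (3 * c * eta * (2 * c * du + Lam * del)) + G * (4 * c ^+ 2 * eta * du)
   + G * (c * eta * (Lam * del)) + G * (3 * c * eta * del)
   + G * (c ^+ 4 * eta * del) + G * (eta * (2 * c * Lam + 3 * c) * del) by ring.
apply: (le_trans (ler_normB _ _)); apply: lerD T6.
apply: (le_trans (ler_normD _ _)); apply: lerD T5.
apply: (le_trans (ler_normD _ _)); apply: lerD T4.
apply: (le_trans (ler_normD _ _)); apply: lerD T3.
exact: le_trans (ler_normD _ _) (lerD T1 T2).
Qed.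
End step.

Definition expsum (R : realType) (ks : seq (R * R)) (y : R * R) : R :=
  \sum_(k <- ks) expo k y.
Definition expsum_gen (R : realType) (beta : R) (ks : seq (R * R)) (y : R * R) : R :=
  \sum_(k <- ks) expo_gen beta k y.

Lemma continuous_nonneg_expo_gen (R : realType) (beta : R) (k : R * R)
    (y1 y2 : R -> R) : continuous_nonneg y1 -> continuous_nonneg y2 ->
  continuous_nonneg (fun s => expo_gen beta k (y1 s, y2 s)).
Proof.
move=> c1 c2; rewrite /expo_gen /expo /=; apply: continuous_nonnegM.
  apply: (@continuous_nonneg_comp _ expR); first exact: continuous_expR.
  by apply: continuous_nonnegD; exact: continuous_nonnegZ.
apply: (@continuous_nonneg_eq _ (fun s => (k.1 * ((-1) * y1 s + y2 s) + (- k.2) * y2 s)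
  + (k.1 ^+ 2 - k.1 * beta))); first by move=> s _; ring.
apply: continuous_nonnegD; last exact: continuous_nonneg_cst.
by do ?[apply: continuous_nonnegD|apply: continuous_nonnegZ].
Qed.

Lemma primitive_sum (R : realType) (I : Type) (s : seq I) (f : I -> R -> R) (t : R) :
  (forall i, continuous_nonneg (f i)) ->
  primitive (fun r => \sum_(i <- s) f i r) t = \sum_(i <- s) primitive (f i) t.
Proof.
move=> cf; elim: s => [|i s IH].
  rewrite big_nil; under eq_Rintegral do rewrite big_nil.
  by rewrite Rintegral_cst // mul0r.
rewrite big_cons -IH; under eq_Rintegral do rewrite big_cons.
rewrite RintegralD //; first exact: continuous_nonneg_integrable.
apply: continuous_nonneg_integrable; elim: s {IH} => [|j s IHs].
  apply: continuous_nonneg_eq (continuous_nonneg_cst 0) => r _.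
  by rewrite big_nil.
apply: continuous_nonneg_eq (continuous_nonnegD (cf j) IHs) => r _.
by rewrite big_cons.
Qed.

Lemma coefficients_bounded (R : realType) (beta : R) (ks : seq (R * R)) :
  exists c, [/\ 1 <= c, `|beta| <= c
    & forall k, k \in ks -> `|k.1| <= c /\ `|k.2| <= c].
Proof.
exists (1 + `|beta| + \sum_(k <- ks) (`|k.1| + `|k.2|)).
have s0 : 0 <= \sum_(k <- ks) (`|k.1| + `|k.2|).
  by apply: sumr_ge0 => k _; rewrite addr_ge0.
have n0 : 0 <= `|beta| by [].
split; [lra|lra|] => k kks.
have : `|k.1| + `|k.2| <= \sum_(k <- ks) (`|k.1| + `|k.2|).
  by rewrite (big_rem k) //= lerDl; apply: sumr_ge0 => j _; rewrite addr_ge0.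
have : 0 <= `|k.1| by []. have : 0 <= `|k.2| by [].
by move: s0 n0; clear; set S := \sum_(_ <- _) _; move=> *; split; lra.
Qed.

(** Summed over [ks], the boundary terms of [expo_step_estimate] cancel by the balance hypothesis,
    and the remainders are eta times a quantity at most exponential in L. The estimate [est] yields
    both claims: eta = 2 L, valid on every grid, gives the bound; small eta on fine grids gives the
    limit. D and r precede the path, as dominated convergence will require. *)
Lemma expsum_riemann (R : realType) (beta T : R) (ks : seq (R * R)) (x : R * R) :
  0 <= T -> (forall y, \sum_(k <- ks) (k.2 - k.1) * expR (k.2 * y) = 0) ->
  exists D r : R, [/\ 0 <= D, 0 <= r & forall w u y1 y2 L,
  reflected_path beta x w u y1 y2 -> T <= L ->
  (forall s, 0 <= s <= T -> [/\ `|y1 s| <= L, `|y2 s| <= L, `|u s| <= L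
     & `|Num.sqrt 2 * w s| <= L]) ->
  let Q n := \sum_(i < n.+1) \sum_(k <- ks)
    expo_step k w y1 y2 (T * i%:R / n.+1%:R) (T * i.+1%:R / n.+1%:R) in
  (forall n, `|Q n| <= D * expR (r * L)) /\
  Q @ \oo --> primitive (fun s => expsum_gen beta ks (y1 s, y2 s)) T].
Proof.
move=> T0 balance.
have [c [c1 bc kc]] := coefficients_bounded beta ks.
have c0 : 0 <= c by apply: le_trans c1.
pose N : R := (size ks)%:R.
(* 10 c^2 comes from [expo_step_estimate]; the 2 absorbs L and L^2, both at most e^(2 L). The
   further 1 in the witness absorbs the L of eta = 2 L. *)
pose r0 := 10 * c ^+ 2 + 2.
pose C1 := 28 * c ^+ 2 + 12 * c ^+ 3 + 6 * c + c ^+ 4.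
pose C2 := 3 * c + 2 * c ^+ 2.
have C10 : 0 <= C1 by rewrite /C1 !addr_ge0 ?mulr_ge0 ?exprn_ge0.
have C20 : 0 <= C2 by rewrite /C2 !addr_ge0 ?mulr_ge0 ?exprn_ge0.
have N0 : 0 <= N by [].
have r00 : 0 <= r0 by rewrite addr_ge0 ?mulr_ge0 ?exprn_ge0.
exists (N * (2 * C1 + C2)), (r0 + 1); split.
- by rewrite mulr_ge0 // addr_ge0 // mulr_ge0.
- by rewrite addr_ge0.
move=> w u y1 y2 L H TL bd Q.
have L0 : 0 <= L by exact: le_trans TL.
have Le : L <= expR L by have := expR_ge1Dx L; lra.
have Le2 : L <= expR (2 * L) by apply: (le_trans Le); rewrite ler_expR; lra.
have L2e : L ^+ 2 <= expR (2 * L).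
  rewrite expr2 -[2 * L]/(2%:R * L) expRM_natl expr2.
  exact: ler_pM.
pose I := primitive (fun s => expsum_gen beta ks (y1 s, y2 s)) T; rewrite -/I.
have IE : I = \sum_(k <- ks) primitive (fun s => expo_gen beta k (y1 s, y2 s)) T.
  apply: primitive_sum => k.
  by apply: continuous_nonneg_expo_gen; [exact: path_y1 H|exact: path_y2 H].
have sum_le (F : R * R -> R) b : (forall k, k \in ks -> `|F k| <= b) ->
    `|\sum_(k <- ks) F k| <= N * b.
  move=> Fb; apply: (le_trans (ler_norm_sum _ _ _)).
  rewrite /N big_seq (le_trans (ler_sum _ Fb)) // -big_seq big_const_seq count_predT.
  by rewrite iter_addr_0 mulr_natl.
have I_le : `|I| <= N * (C2 * expR (r0 * L)).
  rewrite IE; apply: sum_le => k kks; have [k1 k2] := kc k kks.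
  have cg : continuous_nonneg (fun s => expo_gen beta k (y1 s, y2 s)).
    by apply: continuous_nonneg_expo_gen; [exact: path_y1 H|exact: path_y2 H].
  have ig t : 0 <= t -> lebesgue_measure.-integrable `[0, t]
      (fun s => (expo_gen beta k (y1 s, y2 s))%:E).
    by move=> _; exact: continuous_nonneg_integrable.
  have := primitive_increment ig (a := 0)
    (e := expR (2 * c * L) * (3 * c * L + 2 * c ^+ 2)) (lexx 0) T0.
  rewrite primitive0 !subr0 mul0r subr0 => h; apply: (le_trans (h _)).
    move=> s sT; rewrite subr0; have [b1 b2 _ _] := bd s sT.
    exact: expo_gen_bound.
  have -> : r0 * L = 2 * c * L + (2 * L + (10 * c ^+ 2 - 2 * c) * L) by rewrite /r0; ring.
  rewrite expRD [leRHS]mulrCA -[leLHS]mulrA ler_wpM2l ?expR_ge0 // [leLHS]mulrC.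
  apply: (@le_trans _ _ (expR (2 * L) * C2)); last first.
    rewrite [leRHS]mulrC ler_wpM2r // ler_expR lerDl mulr_ge0 // subr_ge0.
    by rewrite expr2 mulrA ler_wpM2r // (le_trans (_ : 2 <= 10)) ?ler_nat // ler_peMr.
  apply: (@le_trans _ _ (L * (3 * c * L + 2 * c ^+ 2))).
    by rewrite ler_wpM2r // addr_ge0 ?mulr_ge0 ?exprn_ge0.
  have h1 := ler_wpM2l c0 L2e; have h2 := ler_wpM2l (exprn_ge0 2 c0) Le2.
  by move: h1 h2; rewrite /C2; clear; rewrite !expr2 => *; lra.
pose t n i : R := T * i%:R / n.+1%:R.
have tS n i : t n i.+1 = t n i + T / n.+1%:R by rewrite /t -(natr1 i) mulrDr mulr1 mulrDl.
have t0 n i : 0 <= t n i by rewrite /t divr_ge0 // mulr_ge0.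
have tT n i : (i <= n.+1)%N -> t n i <= T.
  by move=> iN; rewrite /t ler_pdivrMr // ler_wpM2l // ler_nat.
have tele n (F : R -> R) :
    \sum_(i < n.+1) (F (t n i.+1) - F (t n i)) = F T - F 0.
  rewrite -(big_mkord xpredT (fun i => F (t n i.+1) - F (t n i))).
  by rewrite (@telescope_sumr _ 0 n.+1 (F \o t n)) //= /t mulr0 mul0r mulfK.
have est n eta : T / n.+1%:R <= eta ->
    (forall r s, 0 <= r <= T -> 0 <= s <= T -> `|r - s| <= T / n.+1%:R ->
     [/\ `|y1 r - y1 s| <= eta, `|y2 r - y2 s| <= eta
       & `|Num.sqrt 2 * w r - Num.sqrt 2 * w s| <= eta]) ->
    `|Q n - I| <= N * (C1 * expR (r0 * L) * eta).
  move=> de osc.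
  have eta0 : 0 <= eta by apply: le_trans de; rewrite divr_ge0.
  have -> : Q n - I = \sum_(k <- ks) \sum_(i < n.+1)
     (expo_step k w y1 y2 (t n i) (t n i.+1)
      - (primitive (fun s => expo_gen beta k (y1 s, y2 s)) (t n i.+1)
         - primitive (fun s => expo_gen beta k (y1 s, y2 s)) (t n i))
      - (k.2 - k.1) * expR (k.2 * y2 (t n i)) * (u (t n i.+1) - u (t n i))).
    rewrite [RHS](_ : _ = \sum_(k <- ks) \sum_(i < n.+1) expo_step k w y1 y2 (t n i) (t n i.+1)
       - \sum_(k <- ks) \sum_(i < n.+1)
           (primitive (fun s => expo_gen beta k (y1 s, y2 s)) (t n i.+1)
         - primitive (fun s => expo_gen beta k (y1 s, y2 s)) (t n i))
       - \sum_(k <- ks) \sum_(i < n.+1)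
          (k.2 - k.1) * expR (k.2 * y2 (t n i)) * (u (t n i.+1) - u (t n i))); last first.
      rewrite -!sumrB; apply: eq_bigr => k _; rewrite -!sumrB; exact: eq_bigr.
    rewrite [X in _ = _ - X]exchange_big /= [X in _ = _ - X]big1 ?subr0; last first.
      by move=> i _; rewrite -big_distrl /= balance mul0r.
    rewrite /Q exchange_big /=; congr (_ - _); rewrite IE; apply: eq_bigr => k _.
    rewrite (tele n (fun r => primitive (fun s => expo_gen beta k (y1 s, y2 s)) r)).
    by rewrite primitive0 subr0.
  apply: sum_le => k kks; have [k1 k2] := kc k kks.
  pose Kd := 6 * c * (3 * c * L + 2 * c ^+ 2) + 6 * c + c ^+ 4.
  have Kd0 : 0 <= Kd by rewrite !addr_ge0 ?mulr_ge0 ?addr_ge0 ?mulr_ge0 ?exprn_ge0.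
  apply: (le_trans (ler_norm_sum _ _ _)).
  apply: (@le_trans _ _ (\sum_(i < n.+1) expR (10 * c ^+ 2 * L) * eta *
     (10 * c ^+ 2 * (u (t n i.+1) - u (t n i)) + Kd * (t n i.+1 - t n i)))).
    apply: ler_sum => i _.
    have dt : t n i.+1 - t n i = T / n.+1%:R by rewrite tS addrAC subrr add0r.
    have onT s : t n i <= s <= t n i.+1 -> 0 <= s <= T.
      by move=> /andP[s1 s2]; rewrite (le_trans (t0 n i) s1) (le_trans s2) // tT.
    have d0 : 0 <= T / n.+1%:R by rewrite divr_ge0.
    apply: (expo_step_estimate c1 bc k1 k2 H) => //.
    - by rewrite tS lerDl.
    - by rewrite dt.
    - by rewrite dt (le_trans _ TL) // ler_pdivrMr // ler_peMr // ler1n.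
    - by move=> s /onT /bd[].
    - move=> r s rT sT; apply: osc; [exact: onT|exact: onT|].
      move: rT sT => /andP[r1 r2] /andP[s1 s2]; rewrite -dt.
      by rewrite ler_norml; apply/andP; split; lra.
  rewrite -mulr_sumr big_split /= -!mulr_sumr.
  rewrite (tele n u) (tele n id).
  rewrite (path_u0 H) !subr0.
  have uL : u T <= L.
    have TT : 0 <= T <= T by rewrite T0 lexx.
    by have [_ _ h _] := bd T TT; exact: le_trans (ler_norm _) h.
  apply: (@le_trans _ _ (expR (10 * c ^+ 2 * L) * eta * (expR (2 * L) * C1))); last first.
    have -> : r0 * L = 10 * c ^+ 2 * L + 2 * L by rewrite /r0; ring.
    by rewrite expRD le_eqVlt; apply/orP; left; apply/eqP; ring.
  rewrite ler_wpM2l ?mulr_ge0 ?expR_ge0 //.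
  have h0 : 10 * c ^+ 2 * u T <= 10 * c ^+ 2 * L by rewrite ler_wpM2l // mulr_ge0 ?exprn_ge0.
  have h00 : Kd * T <= Kd * L by rewrite ler_wpM2l.
  have h1 := ler_wpM2l (exprn_ge0 2 c0) L2e; have h2 := ler_wpM2l (exprn_ge0 2 c0) Le2.
  have h3 := ler_wpM2l (exprn_ge0 3 c0) Le2; have h4 := ler_wpM2l (exprn_ge0 4 c0) Le2.
  have h5 := ler_wpM2l c0 Le2.
  by move: h0 h00 h1 h2 h3 h4 h5; rewrite /Kd /C1; clear; move=> *; lra.
have Tn n : T / n.+1%:R <= T by rewrite ler_pdivrMr // ler_peMr // ler1n.
split.
  move=> n; have h : `|Q n - I| <= N * (C1 * expR (r0 * L) * (2 * L)).
    apply: est => [|r s rT sT _]; first by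
      rewrite (le_trans (Tn n)) // (le_trans TL) // ler_peMl // ler1n.
    have [h1 h2 _ h3] := bd r rT; have [h4 h5 _ h6] := bd s sT.
    by split; rewrite (le_trans (ler_normB _ _)) // mulr_natl mulr2n lerD.
  rewrite -[Q n](subrK I) (le_trans (ler_normD _ _)) //.
  apply: (@le_trans _ _ (N * (C1 * expR (r0 * L) * (2 * L)) + N * (C2 * expR (r0 * L)))).
    exact: lerD.
  have -> : expR ((r0 + 1) * L) = expR (r0 * L) * expR L.
    by rewrite mulrDl mul1r expRD.
  rewrite -mulrDr -[leRHS]mulrA ler_wpM2l // [leRHS]mulrDl lerD //.
    have -> : C1 * expR (r0 * L) * (2 * L) = 2 * C1 * expR (r0 * L) * L by ring.
    by rewrite mulrA ler_wpM2l // !mulr_ge0 ?expR_ge0.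
  by rewrite ler_wpM2l // ler_peMr ?expR_ge0 // -[leLHS]expR0 ler_expR.
apply/cvgrPdist_lt => e e0.
(* The added 1 keeps [B] positive when [ks] is empty and makes the final inequality strict. *)
pose B := N * (C1 * expR (r0 * L)) + 1.
have B0 : 0 < B by rewrite ltr_wpDl // !mulr_ge0 ?expR_ge0.
pose eta := e / B; have eta0 : 0 < eta by rewrite divr_gt0.
have [d1 d10 h1] := continuous_nonneg_uniform T (path_y1 H) eta0.
have [d2 d20 h2] := continuous_nonneg_uniform T (path_y2 H) eta0.
have [d3 d30 h3] := continuous_nonneg_uniform T
  (continuous_nonnegZ (Num.sqrt 2) (path_w H)) eta0.
pose d := Num.min (Num.min d1 d2) (Num.min d3 eta).
have d0 : 0 < d by rewrite !lt_min d10 d20 d30.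
exists (Num.bound (T / d)) => // n /= nd.
have dn : T / n.+1%:R < d.
  rewrite ltr_pdivrMr // mulrC -ltr_pdivrMr //.
  apply: (lt_le_trans (archi_boundP _)); first by rewrite divr_ge0 // ltW.
  by rewrite ler_nat (leq_trans nd).
have : `|Q n - I| <= N * (C1 * expR (r0 * L) * eta).
  apply: est => [|r s rT sT rs].
    by move: dn; rewrite !lt_min => /andP[_ /andP[_ /ltW]].
  move: (le_lt_trans rs dn); rewrite !lt_min => /andP[/andP[l1 l2] /andP[l3 _]].
  by split; apply/ltW; [exact: h1|exact: h2|exact: h3].
rewrite distrC => /le_lt_trans; apply.
rewrite (_ : N * _ = (B - 1) * eta); last by rewrite /B; ring.
rewrite -[ltRHS](divfK (lt0r_neq0 B0)) mulrC -/eta ltr_pM2l //.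
by rewrite ltrBlDr ltrDl.
Qed.

(** * Dynkin's formula for sums of exponentials *)

(** The first j steps read only the first j increments, so the approximations of the state at time s
    are functions of W up to s. *)
Lemma measurable_euler (R : realType) (d : measure_display)
    (T : measurableType d) (P : probability T R) (W : R -> {RV P >-> R})
    (beta delta : R) (x : R * R) (t : nat -> R) (j k : nat) :
  (j <= k)%N ->
  let e (w : g_sigma_algebraType (cylinders W t k)) :=
    euler beta delta x (fun i => W (t i.+1) w - W (t i) w) j in
  [/\ measurable_fun setT (fun w => (e w).1.1),
      measurable_fun setT (fun w => (e w).1.2) &
      measurable_fun setT (fun w => (e w).2)].
Proof.
elim: j => [|j IH] jk /=.
  by split; exact: measurable_cst.
have [m1 m2 m3] := IH (ltnW jk).
set e := fun w : g_sigma_algebraType (cylinders W t k) =>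
  euler beta delta x (fun i => W (t i.+1) w - W (t i) w) j.
rewrite -/(e _) in m1 m2 m3.
have md : measurable_fun setT (fun w : g_sigma_algebraType (cylinders W t k) =>
    W (t j.+1) w - W (t j) w) by exact: measurable_increment_cylinders.
have mY : measurable_fun setT (fun w => x.2 + (e w).1.2 - (e w).2).
  by apply: measurable_funB => //; exact: measurable_funD.
have mX : measurable_fun setT (fun w => (e w).1.1 + Num.sqrt 2 * (W (t j.+1) w - W (t j) w)
   - beta * delta + delta * (x.2 + (e w).1.2 - (e w).2 - ((e w).1.1 - (e w).1.2))).
  apply: measurable_funD.
    apply: measurable_funB => //; apply: measurable_funD => //.
    exact: measurable_funM.
  by apply: measurable_funM => //; apply: measurable_funB => //; exact: measurable_funB.
have mC : measurable_fun setT (fun w => (e w).2 + delta * (x.2 + (e w).1.2 - (e w).2)).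
  by apply: measurable_funD => //; exact: measurable_funM.
split.
- apply: eq_measurable_fun mX => w _; rewrite /e.
  by case: (euler _ _ _ _ _) => [[? ?] ?].
- apply: eq_measurable_fun (measurable_maxr m2 mX) => w _; rewrite /e /=.
  by case: (euler _ _ _ _ _) => [[? ?] ?].
- apply: eq_measurable_fun mC => w _; rewrite /e.
  by case: (euler _ _ _ _ _) => [[? ?] ?].
Qed.

(** The state at s is the limit of n + 1 Euler steps over [0, s], which brings it under
    [adapted_integralM]. The factor sqrt 2 turns c^2 (r - s) / 2 into [k.1 ^+ 2 * (r - s)]. *)
Lemma diffusion_expo_mean (R : realType) (beta : R) (x : R * R)
    (d : measure_display) (T : measurableType d) (P : probability T R)
    (W U Y1 Y2 : R -> {RV P >-> R}) (k : R * R) (s r : R) :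
  is_diffusion beta x W U Y1 Y2 -> 0 <= s -> s <= r ->
  (\int[P]_w (expo k (Y1 s w, Y2 s w) *
     expR (k.1 * (Num.sqrt 2 * (W r w - W s w))))%:E =
   \int[P]_w (expo k (Y1 s w, Y2 s w))%:E * (expR (k.1 ^+ 2 * (r - s)))%:E)%E.
Proof.
move=> D s0 sr; have BM := diffusion_brownian D.
pose t n i : R := s * i%:R / n.+1%:R.
have tS n i : t n i <= t n i.+1.
  by rewrite /t ler_wpM2r ?invr_ge0 // ler_wpM2l // ler_nat.
have tk n : t n n.+1 = s by rewrite /t mulfK // pnatr_eq0.
have t0 n : t n 0%N = 0 by rewrite /t mulr0 mul0r.
pose dw w n i := W (t n i.+1) w - W (t n i) w.
pose Xn n w := expo k (euler1 beta (s / n.+1%:R) x (dw w n) n.+1,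
                       euler2 beta (s / n.+1%:R) x (dw w n) n.+1).
under eq_integral do rewrite mulrA.
rewrite (@adapted_integralM _ _ _ P W BM s r (k.1 * Num.sqrt 2) _ Xn t succn) //.
- by congr (_ * (expR _)%:E)%E; rewrite exprMn sqr_sqrtr //; field.
- move=> n; have [m1 m2 m3] :=
    measurable_euler W beta (s / n.+1%:R) x (t n) (leqnn n.+1).
  have mlin : measurable_fun setT
      (fun w : g_sigma_algebraType (cylinders W (t n) n.+1) =>
       k.1 * euler1 beta (s / n.+1%:R) x (dw w n) n.+1
       + k.2 * euler2 beta (s / n.+1%:R) x (dw w n) n.+1).
    apply: measurable_funD; apply: measurable_funM => //.
      exact: measurable_funB.
    by apply: measurable_funB => //; exact: measurable_funD.
  have h := measurableT_comp (@measurable_expR R) mlin.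
  exact: h.
- by move=> n w; exact: expR_ge0.
- move=> w; have [c1 c2] := euler_cvg (diffusion_reflected_path w D) s0.
  apply: (cvg_comp _ expR); last exact: continuous_expR.
  by apply: cvgD; apply: cvgM => //; exact: cvg_cst.
Qed.

(** Integrals of nonnegative functions are suprema over simple functions below them, so the
    comparison reaches s |-> E |g (Y_s)|, whose measurability in s is not established. *)
Lemma ge0_le_integral_bound (R : realType) (d : measure_display)
    (T : measurableType d) (mu : {measure set T -> \bar R}) (D : set T)
    (f g : T -> \bar R) :
  (forall x, D x -> (0 <= f x)%E) -> (forall x, D x -> (f x <= g x)%E) ->
  (\int[mu]_(x in D) f x <= \int[mu]_(x in D) g x)%E.
Proof.
move=> f0 fg; rewrite [leLHS]integral_mkcond [leRHS]integral_mkcond.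
have fg' x : ((f \_ D) x <= (g \_ D) x)%E by apply: lee_restrict.
have f0' x : (0 <= (f \_ D) x)%E by apply: erestrict_ge0.
rewrite !ge0_integralTE //; last by move=> x; exact: le_trans (fg' x).
apply: ereal_sup_le => _ [h hf <-]; exists h => // x.
exact: le_trans (fg' x).
Qed.

Lemma diffusion_exp_dominated (R : realType) (beta : R) (x : R * R)
    (d : measure_display) (T : measurableType d) (P : probability T R)
    (W U Y1 Y2 : R -> {RV P >-> R}) (t r : R) :
  0 <= beta -> is_diffusion beta x W U Y1 Y2 -> 0 <= t -> 0 <= r ->
  exists2 G : T -> \bar R, P.-integrable setT G & forall w, exists L : R,
   [/\ t <= L, (forall s, 0 <= s <= t -> [/\ `|Y1 s w| <= L, `|Y2 s w| <= L,
     `|U s w| <= L & `|Num.sqrt 2 * W s w| <= L]) &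
     ((expR (r * L))%:E <= G w)%E].
Proof.
move=> beta0 D t0 r0.
have [K K0 hK] := reflected_path_bound x beta0 t0.
have rK0 : 0 <= r * K by rewrite mulr_ge0.
have [G iG hG] := brownian_exp_dominated (diffusion_brownian D) t0 rK0.
exists (fun w => (expR (r * (K + t)))%:E * G w)%E; first exact: integrableZl.
(* The summand t secures t <= L, which [expsum_riemann] asks for. *)
move=> w; have [S [S0 WS eS]] := hG w; exists (K * (1 + S) + t); split.
- by rewrite lerDr mulr_ge0 // addr_ge0.
- move=> s st.
  have [h1 h2 h3 h4] := hK _ _ _ _ _ (diffusion_reflected_path w D) S0 WS s st.
  have hL : K * (1 + S) <= K * (1 + S) + t by rewrite lerDl.
  by split; apply: le_trans hL.
- have -> : r * (K * (1 + S) + t) = r * (K + t) + r * K * S by ring.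
  by rewrite expRD EFinM lee_pmul2l // lte_fin expR_gt0.
Qed.

Lemma mean0_sum (R : realType) (d : measure_display) (T : measurableType d)
    (P : {measure set T -> \bar R}) (I : eqType) (s : seq I) (F : I -> T -> R) :
  (forall i, i \in s -> P.-integrable setT (fun w => (F i w)%:E) /\
    \int[P]_w F i w = 0) ->
  P.-integrable setT (fun w => (\sum_(i <- s) F i w)%:E) /\
  \int[P]_w (\sum_(i <- s) F i w) = 0.
Proof.
elim: s => [_|i s IH h].
  under eq_fun do rewrite big_nil; split; first exact: integrable0.
  by under eq_Rintegral do rewrite big_nil; rewrite /Rintegral integral0.
have [j js|i2 e2] := IH; first by apply: h; rewrite inE js orbT.
have [i1 e1] := h i (mem_head _ _).
split.
  under eq_fun do rewrite big_cons EFinD.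
  exact: integrableD.
under eq_Rintegral do rewrite big_cons.
by rewrite RintegralD // e1 e2 addr0.
Qed.

Lemma expsum_gen_bound (R : realType) (beta c L : R) (ks : seq (R * R)) (y1 y2 : R) :
  `|beta| <= c -> (forall k, k \in ks -> `|k.1| <= c /\ `|k.2| <= c) ->
  `|y1| <= L -> `|y2| <= L ->
  `|expsum_gen beta ks (y1, y2)| <=
  (size ks)%:R * (3 * c + 2 * c ^+ 2) * expR ((2 * c + 1) * L).
Proof.
move=> bc kc h1 h2.
have c0 : 0 <= c by exact: le_trans (normr_ge0 _) bc.
have L0 : 0 <= L by exact: le_trans (normr_ge0 _) h1.
apply: (le_trans (ler_norm_sum _ _ _)); rewrite big_seq.
apply: (@le_trans _ _ (\sum_(k <- ks | k \in ks)
    ((3 * c + 2 * c ^+ 2) * expR ((2 * c + 1) * L)))).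
  apply: ler_sum => k kks; have [k1 k2] := kc k kks.
  apply: (le_trans (@expo_gen_bound _ _ _ _ bc k1 k2 L (y1, y2) h1 h2)).
  have Le : L <= expR L by have := expR_ge1Dx L; lra.
  have e1 : 1 <= expR L by rewrite -[leLHS]expR0 ler_expR.
  apply: (@le_trans _ _ (expR (2 * c * L) * ((3 * c + 2 * c ^+ 2) * expR L))).
    rewrite ler_wpM2l ?expR_ge0 // [leRHS]mulrDl lerD //.
      by rewrite ler_wpM2l // mulr_ge0.
    by rewrite ler_peMr // mulr_ge0 // exprn_ge0.
  by rewrite mulrCA -expRD (_ : (2 * c + 1) * L = 2 * c * L + L) //; ring.
by rewrite -big_seq big_const_seq count_predT iter_addr_0 -[leLHS]mulr_natl mulrA.
Qed.

Lemma measurable_expo_gen (R : realType) (beta : R) (k : R * R) :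
  measurable_fun setT (expo_gen beta k).
Proof.
apply: measurable_funM.
  have mlin : measurable_fun setT (fun y : R * R => k.1 * y.1 + k.2 * y.2).
    by apply: measurable_funD; exact: measurable_funM.
  exact: (measurableT_comp (@measurable_expR R) mlin).
apply: measurable_funD => //; apply: measurable_funB; apply: measurable_funM => //.
apply: measurable_funB => //; apply: measurable_funD => //.
exact: measurableT_comp.
Qed.

(** On every grid the mean of [Q n] is exactly E V(Y_t) - V(x), because [Q n] differs from V(Y_t) -
    V(x) by the mean zero terms [M]. On each path [Q n] tends to the time integral of the generator,
    under one integrable bound, so the constant sequence of means equals the mean of the limit. *)
Lemma expsum_extended_generator (R : realType) (beta : R) (ks : seq (R * R)) :
  0 <= beta -> (forall y, \sum_(k <- ks) (k.2 - k.1) * expR (k.2 * y) = 0) ->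
  extended_generator beta (expsum ks) (expsum_gen beta ks).
Proof.
move=> beta0 balance; split.
  apply: measurable_funTS; apply: measurable_sum => k.
  exact: measurable_expo_gen.
move=> x d T P W U Y1 Y2 Ox D t t0.
have [c [c1 bc kc]] := coefficients_bounded beta ks.
have c0 : 0 <= c by exact: le_trans c1.
have [Dc [r [Dc0 r0 riem]]] := @expsum_riemann R beta t ks x t0 balance.
(* One rate for all dominations: r for the Riemann sums, 2 c for an exponential of the state, 4 c
   for its product with a Brownian factor, 2 c + 1 for the generator. *)
pose rr := r + 6 * c + 1.
have rr0 : 0 <= rr by rewrite /rr !addr_ge0 // mulr_ge0.
have [G iG hG] := diffusion_exp_dominated beta0 D t0 rr0.
have domint (C : R) (f : T -> R) : measurable_fun setT f -> 0 <= C ->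
    (forall w L, t <= L -> (forall s, 0 <= s <= t -> [/\ `|Y1 s w| <= L,
      `|Y2 s w| <= L, `|U s w| <= L & `|Num.sqrt 2 * W s w| <= L]) ->
      `|f w| <= C * expR (rr * L)) ->
    P.-integrable setT (fun w => (f w)%:E) /\
    (\int[P]_w `|f w|%:E <= C%:E * \int[P]_w G w)%E.
  move=> mf C0 hf.
  have fG w : (`|f w|%:E <= C%:E * G w)%E.
    have [L [tL bd LG]] := hG w.
    apply: (@le_trans _ _ (C%:E * (expR (rr * L))%:E)%E).
      by rewrite -EFinM lee_fin; exact: hf.
    by apply: lee_wpmul2l.
  have iCG : P.-integrable setT (fun w => C%:E * G w)%E by exact: integrableZl.
  split.
    apply: le_integrable iCG => //; first exact/measurable_EFinP.
    by move=> w _; rewrite /= (le_trans (fG w)) // lee_abs.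
  rewrite -integralZl //; apply: ge0_le_integral => //.
  - by apply/measurable_EFinP; exact: measurableT_comp.
  - exact: measurable_int iCG.
pose E k s w := expo k (Y1 s w, Y2 s w).
have mE k s : measurable_fun setT (E k s).
  have mlin : measurable_fun setT (fun w => k.1 * Y1 s w + k.2 * Y2 s w).
    by apply: measurable_funD; exact: measurable_funM.
  exact: (measurableT_comp (@measurable_expR R) mlin).
have tt : 0 <= t <= t by rewrite t0 lexx.
have expL k s w L : k \in ks -> 0 <= s <= t -> t <= L ->
    (forall s, 0 <= s <= t -> [/\ `|Y1 s w| <= L, `|Y2 s w| <= L, `|U s w| <= L
       & `|Num.sqrt 2 * W s w| <= L]) ->
    `|E k s w| <= expR (2 * c * L).
  move=> kks st tL bd; have [h1 h2 _ _] := bd s st; have [k1 k2] := kc k kks.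
  rewrite ger0_norm ?expR_ge0 // ler_expR (le_trans (ler_norm _)) //.
  exact: (@expo_exponent_bound _ c k k1 k2 L (Y1 s w, Y2 s w)).
have exprr a L : a <= rr -> t <= L -> expR (a * L) <= expR (rr * L).
  by move=> arr tL; rewrite ler_expR ler_wpM2r // (le_trans t0).
have [rrr c2rr c4rr] : [/\ r <= rr, 2 * c <= rr & 4 * c <= rr].
  by rewrite /rr; move: r0 c0; clear; split; lra.
have iE k s : k \in ks -> 0 <= s <= t -> P.-integrable setT (fun w => (E k s w)%:E).
  move=> kks st; have [] // := domint 1 (E k s) (mE k s) ler01.
  move=> w L tL bd; rewrite mul1r (le_trans (expL k s w L kks st tL bd)) //.
  exact: exprr.
pose F k s s' w := E k s w * expR (k.1 * (Num.sqrt 2 * (W s' w - W s w))).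
have iF k s s' : k \in ks -> 0 <= s <= t -> 0 <= s' <= t ->
    P.-integrable setT (fun w => (F k s s' w)%:E).
  move=> kks st st'; have [] // := domint 1 (F k s s').
    apply: measurable_funM => //.
    have mlin : measurable_fun setT (fun w => k.1 * (Num.sqrt 2 * (W s' w - W s w))).
      do 2 apply: measurable_funM => //; exact: measurable_funB.
    exact: (measurableT_comp (@measurable_expR R) mlin).
  move=> w L tL bd; rewrite mul1r (le_trans _ (exprr _ _ c4rr tL)) //.
  have -> : 4 * c * L = 2 * c * L + 2 * c * L by ring.
  rewrite expRD /F normrM; apply: ler_pM => //; first exact: expL tL bd.
  rewrite ger0_norm ?expR_ge0 // ler_expR.
  have [_ _ _ h1] := bd s st; have [_ _ _ h2] := bd s' st'; have [k1 _] := kc k kks.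
  have g1 : `|k.1 * (Num.sqrt 2 * W s w)| <= c * L by rewrite normrM ler_pM.
  have g2 : `|k.1 * (Num.sqrt 2 * W s' w)| <= c * L by rewrite normrM ler_pM.
  rewrite (le_trans (ler_norm _)) // !mulrBr (le_trans (ler_normB _ _)) //.
  have -> : 2 * c * L = c * L + c * L by ring.
  exact: lerD.
pose p n i : R := t * i%:R / n.+1%:R.
have p0 n i : 0 <= p n i by rewrite /p divr_ge0 // mulr_ge0.
have pT n i : (i <= n.+1)%N -> 0 <= p n i <= t.
  by move=> iN; rewrite p0 /p ler_pdivrMr // ler_wpM2l // ler_nat.
have pS n i : p n i <= p n i.+1.
  by rewrite /p ler_wpM2r ?invr_ge0 // ler_wpM2l // ler_nat.
(* The state times its Brownian factor minus the mean of that factor; [diffusion_expo_mean] gives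
   mean zero. *)
pose M n k i w := F k (p n i) (p n i.+1) w
  - expR (k.1 ^+ 2 * (p n i.+1 - p n i)) * E k (p n i) w.
have M0 n k i : k \in ks -> (i < n.+1)%N ->
    P.-integrable setT (fun w => (M n k i w)%:E) /\ \int[P]_w M n k i w = 0.
  move=> kks iN; have pi := pT n i (ltnW iN); have pi1 := pT n i.+1 iN.
  have i1 := iF k _ _ kks pi pi1; have i2 := iE k _ kks pi.
  have i3 : P.-integrable setT
      (fun w => (expR (k.1 ^+ 2 * (p n i.+1 - p n i)) * E k (p n i) w)%:E).
    under eq_fun do rewrite EFinM; exact: integrableZl.
  split; first by under eq_fun do rewrite EFinB; exact: integrableB.
  rewrite RintegralB // RintegralZl //; apply/eqP; rewrite subr_eq0; apply/eqP.
  have := diffusion_expo_mean k D (p0 n i) (pS n i).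
  rewrite /Rintegral /F => ->; rewrite fineM //=; first by rewrite mulrC.
  exact: integrable_fin_num.
pose Q n w := \sum_(i < n.+1) \sum_(k <- ks) expo_step k (W^~ w) (Y1^~ w) (Y2^~ w)
   (t * i%:R / n.+1%:R) (t * i.+1%:R / n.+1%:R).
have QE n w : Q n w = (expsum ks (Y1 t w, Y2 t w) - expsum ks x)
    - \sum_(i < n.+1) \sum_(k <- ks) M n k i w.
  rewrite -(diffusion_start D w) /Q /expsum.
  have -> : \sum_(k <- ks) expo k (Y1 t w, Y2 t w) - \sum_(k <- ks) expo k (Y1 0 w, Y2 0 w)
     = \sum_(i < n.+1) \sum_(k <- ks) (E k (p n i.+1) w - E k (p n i) w).
    rewrite exchange_big /= -sumrB; apply: eq_bigr => k _.
    rewrite -(big_mkord xpredT (fun i => E k (p n i.+1) w - E k (p n i) w)).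
    by rewrite (@telescope_sumr _ 0 n.+1 (fun i => E k (p n i) w)) //= /p mulr0 mul0r mulfK.
  rewrite -sumrB; apply: eq_bigr => i _; rewrite -sumrB; apply: eq_bigr => k _.
  by rewrite /expo_step /M /F -/(p n i) -/(p n i.+1) /E; ring.
have sM n : P.-integrable setT (fun w => (\sum_(i < n.+1) \sum_(k <- ks) M n k i w)%:E)
    /\ \int[P]_w (\sum_(i < n.+1) \sum_(k <- ks) M n k i w) = 0.
  apply: mean0_sum => i _; apply: mean0_sum => k kks; exact: M0.
have iV : P.-integrable setT (fun w => (expsum ks (Y1 t w, Y2 t w))%:E).
  under eq_fun do rewrite /expsum big_seq -sumEFin.
  by apply: integrable_sum => // k kks; exact: iE.
have iV0 : P.-integrable setT (fun w => (expsum ks (Y1 t w, Y2 t w) - expsum ks x)%:E).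
  under eq_fun do rewrite EFinB; apply: integrableB => //.
  exact: finite_measure_integrable_cst.
have iQ n : P.-integrable setT (fun w => (Q n w)%:E).
  under eq_fun do rewrite QE EFinB; apply: integrableB => //.
  exact: (sM n).1.
have intQ n : (\int[P]_w (Q n w)%:E = (\int[P]_w expsum ks (Y1 t w, Y2 t w) - expsum ks x)%:E)%E.
  rewrite -[LHS]fineK; last exact: integrable_fin_num.
  congr (_%:E); rewrite -[LHS]/(\int[P]_w Q n w).
  under eq_Rintegral do rewrite QE.
  rewrite RintegralB //; last exact: (sM n).1.
  rewrite (sM n).2 subr0 RintegralB //; last exact: finite_measure_integrable_cst.
  have PT : fine (P setT) = 1 by rewrite probability_setT.
  by rewrite Rintegral_cst // PT mulr1.
have mQ n : measurable_fun setT (Q n) by apply/measurable_EFinP; exact: measurable_int (iQ n).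
pose I w := primitive (fun s => expsum_gen beta ks (Y1 s w, Y2 s w)) t.
have rie w L tL bd := riem _ _ _ _ L (diffusion_reflected_path w D) tL bd.
have [_ cI] : P.-integrable setT (fun w => (I w)%:E) /\
    (\int[P]_w (Q n w)%:E)%E @[n --> \oo] --> (\int[P]_w (I w)%:E)%E.
  apply: (@real_dominated_convergence _ _ _ P Q I (fun w => Dc%:E * G w)%E) => //.
  - by move=> w; have [L [tL bd _]] := hG w; exact: (rie w L tL bd).2.
  - exact: integrableZl.
  - move=> n w; have [L [tL bd LG]] := hG w.
    apply: (@le_trans _ _ (Dc%:E * (expR (rr * L))%:E)%E).
      rewrite -EFinM lee_fin (le_trans ((rie w L tL bd).1 n)) // ler_wpM2l //.
      by apply: exprr => //; exact: rrr.
    by apply: lee_wpmul2l.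
have eI : (\int[P]_w (I w)%:E = (\int[P]_w expsum ks (Y1 t w, Y2 t w) - expsum ks x)%:E)%E.
  have eQ := funext intQ.
  by move: cI; rewrite eQ => cI; apply: (cvg_unique _ cI) => //; exact: cvg_cst.
pose C := (size ks)%:R * (3 * c + 2 * c ^+ 2).
have C0 : 0 <= C by rewrite mulr_ge0 // addr_ge0 ?mulr_ge0 ?exprn_ge0.
have c21 : 2 * c + 1 <= rr by rewrite /rr; move: r0 c0; clear; lra.
have genL s : 0 <= s <= t ->
    (\int[P]_w `|(expsum_gen beta ks (Y1 s w, Y2 s w))%:E| <= C%:E * \int[P]_w G w)%E.
  move=> st.
  have [||//|_ h] := domint C (fun w => expsum_gen beta ks (Y1 s w, Y2 s w)).
  - apply: (measurableT_comp (f := expsum_gen beta ks)).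
      by apply: measurable_sum => k; exact: measurable_expo_gen.
    exact: measurable_fun_pair.
  - done.
  - move=> w L tL bd; have [h1 h2 _ _] := bd s st.
    have L0 : 0 <= L by exact: le_trans tL.
    apply: (le_trans (expsum_gen_bound bc kc h1 h2)).
    by rewrite -/C ler_wpM2l // ler_expR ler_wpM2r // c21.
  exact: h.
split => //.
(* The bound [genL] is the same for all s in [0, t]. *)
- apply: (@le_lt_trans _ _ (\int[lebesgue_measure]_(s in `[0%R, t]) (C%:E * \int[P]_w G w))%E).
    apply: ge0_le_integral_bound => s; first by move=> _; exact: integral_ge0.
    by rewrite /= in_itv /=; exact: genL.
  have fG : (C%:E * \int[P]_w G w)%E \is a fin_num.
    by rewrite fin_numM // integrable_fin_num.
  rewrite integral_cst //= lebesgue_measure_itv /= lte_mul_pinfty //;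
    last by case: ifP; rewrite ?ltry.
  rewrite mule_ge0 // integral_ge0 // => w _; have [L [_ _ LG]] := hG w.
  by apply: le_trans LG; rewrite lee_fin expR_ge0.
(* Continuity of the path makes the inner integral finite, hence equal to the real number [I w]. *)
- have -> : (\int[P]_w \int[lebesgue_measure]_(s in `[0%R, t])
      (expsum_gen beta ks (Y1 s w, Y2 s w))%:E = \int[P]_w (I w)%:E)%E.
    apply: eq_integral => w _; rewrite /I /Rintegral fineK //.
    apply: integrable_fin_num => //; apply: continuous_nonneg_integrable => //.
    have H := diffusion_reflected_path w D.
    rewrite /expsum_gen; elim: (ks) => [|k s IH].
      by apply: continuous_nonneg_eq (continuous_nonneg_cst 0) => s _; rewrite big_nil.
    apply: continuous_nonneg_eq (continuous_nonnegD
      (continuous_nonneg_expo_gen beta k (path_y1 H) (path_y2 H)) IH) => s' _.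
    by rewrite big_cons.
  rewrite eI EFinB unlock; congr (_ - _)%E.
    rewrite fineK //; exact: integrable_fin_num.
  under eq_integral do rewrite (diffusion_start D).
  rewrite integral_cst // -[RHS]mule1; congr (_ * _)%E; exact: probability_setT.
Qed.

(** * The Lyapunov function *)

(** With n = - x1 and y = x2, the left side is the generator on e^(th x1) + e^(- th x1). The y terms
    combine to - th y (E - F) <= 0. Once n >= beta + th + 1 / th, one has th (n - beta) - th^2 >= 1,
    which gives the decay - E; for smaller n everything is bounded by the constant. *)
Lemma lyapunov_horizontal (R : realType) (th beta n y : R) :
  0 < th -> 0 <= beta -> 0 <= n -> 0 <= y ->
  expR (th * n) * (- th * (n + y - beta) + th ^+ 2)
  + expR (- (th * n)) * (th * (n + y - beta) + th ^+ 2) <=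
  - expR (th * n)
  + (1 + th * beta + 2 * th ^+ 2) * expR (th * (beta + th + th^-1)).
Proof.
move=> th0 b0 n0 y0; set E := expR (th * n); set F := expR (- (th * n)).
have thn : 0 <= th * n by rewrite mulr_ge0 // ltW.
have F0 : 0 <= F by exact: expR_ge0.
have E1 : 1 <= E by rewrite -[leLHS]expR0 ler_expR.
have EF : F * E = 1 by rewrite -expRD addNr expR0.
have F1 : F <= 1 by rewrite -[leRHS]expR0 ler_expR oppr_le0.
have thF : th * n * F <= 1.
  rewrite -EF mulrC ler_wpM2l //.
  by have := expR_ge1Dx (th * n); rewrite -/E; lra.
have c0 : 0 <= th * beta by rewrite mulr_ge0 // ltW.
have s0 : 0 <= th ^+ 2 by rewrite exprn_ge0 // ltW.
set N := beta + th + th^-1; have tN : th * N = th * beta + th ^+ 2 + 1.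
  by rewrite /N; field; rewrite lt0r_neq0.
set X := expR (th * N).
have X1 : 1 <= X.
  rewrite -[leLHS]expR0 ler_expR tN; lra.
have -> : E * (- th * (n + y - beta) + th ^+ 2) + F * (th * (n + y - beta) + th ^+ 2)
  = - ((E - F) * (th * n - th * beta)) - th * y * (E - F) + th ^+ 2 * (E + F) by ring.
have EF0 : 0 <= E - F by lra.
have g1 : 0 <= th * y * (E - F) by rewrite !mulr_ge0 // ltW.
have [Nn|nN] := leP N n.
  have g2 : th * N <= th * n by rewrite ler_pM2l.
  have g3 : 0 <= E * (th * n - th * N) by rewrite mulr_ge0 ?subr_ge0 // (le_trans _ E1).
  have g4 : 0 <= F * (th * beta) by rewrite mulr_ge0.
  have g5 : 0 <= th ^+ 2 * (1 - F) by rewrite mulr_ge0 ?subr_ge0.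
  have g6 : 0 <= (1 + th * beta + 2 * th ^+ 2) * (X - 1).
    by rewrite mulr_ge0 ?subr_ge0 // !addr_ge0 // mulr_ge0.
  move: g1 g3 g4 g5 g6 thF; rewrite tN; move: c0 s0; clear.
  move=> *; lra.
have EX : E <= X by rewrite ler_expR ler_pM2l // ltW.
have g2 : 0 <= (E - F) * (th * n) by rewrite mulr_ge0.
have g3 : 0 <= F * (th * beta) by rewrite mulr_ge0.
have g4 : 0 <= th ^+ 2 * (E - F) by rewrite mulr_ge0.
have g6 : 0 <= (1 + th * beta + 2 * th ^+ 2) * (X - E).
  by rewrite mulr_ge0 ?subr_ge0 // !addr_ge0 // mulr_ge0.
move: g1 g2 g3 g4 g6; clear.
by move=> *; lra.
Qed.

(** [q] is the value of H at n = beta / 4, where the two regimes meet. Below, H >= q and 2 n - beta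
    <= - beta / 2 give the rate h. Above, H <= q, and z e^(-z) <= 1 at z = 2 th n bounds 2 n H by 1
    / th; then - y (1 - q) + 1 / th <= - h once y >= (h + 1 / th) / (1 - q), and smaller y are
    covered by the constant. *)
Lemma lyapunov_vertical (R : realType) (beta n y : R) :
  0 < beta -> 0 <= n -> 0 <= y ->
  let th := beta / 4 in let q := expR (- (beta ^+ 2 / 8)) in
  let H := expR (- (2 * th * n)) in let h := beta / 2 * q in
  th * expR (th * y) * (- y * (1 - H) + H * (2 * n - beta)) <=
  - (th * h) * expR (th * y)
  + th * (h + th^-1) * expR (th * ((h + th^-1) / (1 - q))).
Proof.
move=> b0 n0 y0; cbv zeta; set th := beta / 4; set q := expR (- (beta ^+ 2 / 8)).
set H := expR (- (2 * th * n)); set h := beta / 2 * q.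
have th0 : 0 < th by rewrite divr_gt0.
have q0 : 0 < q by exact: expR_gt0.
have q1 : q < 1 by rewrite -[ltRHS]expR0 ltr_expR oppr_lt0 divr_gt0 // exprn_gt0.
have h0 : 0 < h by rewrite mulr_gt0 // divr_gt0.
have H0 : 0 <= H by exact: expR_ge0.
have H1 : H <= 1 by rewrite -[leRHS]expR0 ler_expR oppr_le0 !mulr_ge0 // ltW.
have tV : 0 < th^-1 by rewrite invr_gt0.
set G := expR (th * y); have G0 : 0 <= G by exact: expR_ge0.
set X := expR _; have X0 : 0 <= X by exact: expR_ge0.
have [nb|bn] := leP n (beta / 4).
  have qH : q <= H.
    rewrite ler_expR lerN2 /th.
    have -> : beta ^+ 2 / 8 = 2 * (beta / 4) * (beta / 4) by field.
    by rewrite ler_wpM2l // mulr_ge0 // ltW.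
  have hh : - y * (1 - H) + H * (2 * n - beta) <= - h.
    have g1 : 0 <= y * (1 - H) by rewrite mulr_ge0 ?subr_ge0.
    have g2 : 0 <= H * (beta / 2 - 2 * n) by rewrite mulr_ge0 // subr_ge0; lra.
    have g3 : 0 <= beta * (H - q) by rewrite mulr_ge0 ?subr_ge0 // ltW.
    by move: g1 g2 g3; rewrite /h; clear; move=> *; lra.
  have := ler_wpM2l (mulr_ge0 (ltW th0) G0) hh.
  have : 0 <= th * (h + th^-1) * X by rewrite !mulr_ge0 ?addr_ge0 // ltW.
  by clear; move=> *; lra.
have Hq : H <= q.
  rewrite ler_expR lerN2 /th.
  have -> : beta ^+ 2 / 8 = 2 * (beta / 4) * (beta / 4) by field.
  by rewrite ler_wpM2l ?mulr_ge0 // ltW.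
have hh : - y * (1 - H) + H * (2 * n - beta) <= - (y * (1 - q)) + th^-1.
  have g1 : 0 <= y * (q - H) by rewrite mulr_ge0 ?subr_ge0.
  have g2 : 0 <= H * beta by rewrite mulr_ge0 // ltW.
  have g3 : H * (2 * n) <= th^-1.
    rewrite -[leRHS]mul1r ler_pdivlMr //.
    apply: (@le_trans _ _ (H * expR (2 * th * n))); last first.
      by rewrite -expRD addNr expR0.
    have -> : H * (2 * n) * th = H * (2 * th * n) by ring.
    by rewrite ler_wpM2l //; have := expR_ge1Dx (2 * th * n); lra.
  by move: g1 g2 g3; clear; move=> *; lra.
apply: (le_trans (ler_wpM2l (mulr_ge0 (ltW th0) G0) hh)).
have r0 : 0 < 1 - q by rewrite subr_gt0.
have [Yy|yY] := leP ((h + th^-1) / (1 - q)) y.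
  have : 0 <= th * G * (y * (1 - q) - (h + th^-1)).
    by rewrite !mulr_ge0 ?subr_ge0 -?ler_pdivrMr // ltW.
  have : 0 <= th * (h + th^-1) * X by rewrite !mulr_ge0 ?addr_ge0 // ltW.
  by clear; move=> *; lra.
have GX : 0 <= th * (h + th^-1) * (X - G).
  apply: mulr_ge0; first by rewrite mulr_ge0 ?addr_ge0 // ltW.
  by rewrite subr_ge0 ler_expR ler_pM2l // ltW.
have : 0 <= th * G * (y * (1 - q)) by rewrite !mulr_ge0 // ltW.
by move: GX; clear; move=> *; lra.
Qed.

Definition lyapunov_exponents (R : realType) (th : R) : seq (R * R) :=
  [:: (th, 0); (- th, 0); (0, th); (2 * th, th)].

(** The rate is written 2 c because half of the decay will be spent on absorbing D outside a compact
    set. *)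
Lemma lyapunov_drift (R : realType) (beta : R) : 0 < beta ->
  exists c D : R, [/\ 0 < c, 0 < D & forall x, Omega x ->
    expsum_gen beta (lyapunov_exponents (beta / 4)) x <=
    - (2 * c) * expsum (lyapunov_exponents (beta / 4)) x + D].
Proof.
move=> b0; set th := beta / 4.
have th0 : 0 < th by rewrite divr_gt0 //.
pose q := expR (- (beta ^+ 2 / 8)); pose h := beta / 2 * q.
pose D1 := (1 + th * beta + 2 * th ^+ 2) * expR (th * (beta + th + th^-1)).
pose D2 := th * (h + th^-1) * expR (th * ((h + th^-1) / (1 - q))).
have q0 : 0 < q by exact: expR_gt0.
have h0 : 0 < h by rewrite mulr_gt0 // divr_gt0.
have m0 : 0 < th * h by rewrite mulr_gt0.
have D10 : 0 < D1.
  rewrite mulr_gt0 ?expR_gt0 // ltr_wpDr ?mulr_ge0 ?exprn_ge0 ?(ltW th0) ?(ltW b0) //.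
  by rewrite ltr_wpDr // mulr_ge0 // ltW.
have D20 : 0 <= D2 by rewrite !mulr_ge0 ?expR_ge0 ?addr_ge0 ?invr_ge0 // ltW.
pose m := Num.min 1 (th * h).
have mp : 0 < m by rewrite lt_min ltr01 m0.
(* V <= 2 E + 2 G, as F <= E and H G <= G; hence m (E + G) >= (m / 2) V, and 2 c = m / 2. *)
exists (m / 4), (D1 + D2); split; [by rewrite divr_gt0|by rewrite ltr_wpDr|].
move=> [x y] [/= x0 y0].
have n0 : 0 <= - x by rewrite oppr_ge0.
have A := lyapunov_horizontal th0 (ltW b0) n0 y0.
have B := lyapunov_vertical b0 n0 y0.
rewrite /= -/th -/q -/h -/D2 in B; rewrite -/D1 in A.
move: A B; set E := expR (th * - x); set F := expR (- (th * - x)).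
set G := expR (th * y); set H := expR (- (2 * th * - x)) => A B.
rewrite /expsum /expsum_gen /lyapunov_exponents !big_cons !big_nil /expo_gen /expo /=.
have -> : expR (th * x + 0 * y) = F by congr expR; ring.
have -> : expR (- th * x + 0 * y) = E by congr expR; ring.
have -> : expR (0 * x + th * y) = G by congr expR; ring.
have -> : expR (2 * th * x + th * y) = H * G by rewrite -expRD; congr expR; ring.
have F0 : 0 <= F by exact: expR_ge0.
have G0 : 0 <= G by exact: expR_ge0.
have xt : 0 <= th * - x by rewrite mulr_ge0 // ltW.
have FE : F <= E by rewrite ler_expR; lra.
have H1 : H <= 1 by rewrite -[leRHS]expR0 ler_expR oppr_le0 -mulrA mulr_ge0.
have HG : H * G <= G by rewrite ler_piMl.
have m1 : m <= 1 by rewrite ge_min lexx.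
have m2 : m <= th * h by rewrite ge_min lexx orbT.
have E0 : 0 <= E by exact: le_trans FE.
have g1 : m * E <= 1 * E by rewrite ler_wpM2r.
have g2 : m * G <= th * h * G by rewrite ler_wpM2r.
have g3 : m * F <= m * E by rewrite ler_wpM2l // ltW.
have g4 : m * (H * G) <= m * G by rewrite ler_wpM2l // ltW.
have := lerD A B.
set Z := (X in X <= _ -> _) => ZAB.
(* Here th = beta / 4 matters: 4 th^2 = th beta merges the second-order term of e^(2 th x1 + th x2)
   with its drift. *)
set Y := (X in X <= _); have -> : Y = Z by rewrite /Y /Z /th; field.
apply: (le_trans ZAB); move: g1 g2 g3 g4; clear; move=> *; lra.
Qed.

(** * Boundary derivatives and growth of the Lyapunov function *)

Lemma has_partial1_derive (R : realType) (f : R * R -> R) (x : R * R) (l : R) :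
  is_derive (0 : R) 1 (fun h => f (x.1 + h, x.2)) l -> has_partial1 f x l.
Proof.
(* A two-sided limit restricts to the increments that stay in Omega. *)
move=> [df dE]; apply: cvg_within_filter; rewrite -dE.
have -> : (fun h => (f (x.1 + h, x.2) - f x) / h) =
  (fun h : R => h^-1 *: (((fun h => f (x.1 + h, x.2)) \o shift 0) (h *: 1) -
     f (x.1 + 0, x.2))).
  by apply/funext => h /=; rewrite !addr0 [h *: 1]mulr1 [RHS]mulrC -surjective_pairing.
exact: df.
Qed.

Lemma has_partial2_derive (R : realType) (f : R * R -> R) (x : R * R) (l : R) :
  is_derive (0 : R) 1 (fun h => f (x.1, x.2 + h)) l -> has_partial2 f x l.
Proof.
move=> [df dE]; apply: cvg_within_filter; rewrite -dE.
have -> : (fun h => (f (x.1, x.2 + h) - f x) / h) =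
  (fun h : R => h^-1 *: (((fun h => f (x.1, x.2 + h)) \o shift 0) (h *: 1) -
     f (x.1, x.2 + 0))).
  by apply/funext => h /=; rewrite !addr0 [h *: 1]mulr1 [RHS]mulrC -surjective_pairing.
exact: df.
Qed.

Lemma is_derive_expR_affine (R : realType) (a b : R) :
  is_derive (0 : R) 1 (fun h : R => expR (a * h + b)) (a * expR b).
Proof.
have d1 : is_derive (0 : R) 1 (fun h : R => a * h + b) a.
  have -> : (fun h : R => a * h + b) = (a \*: id) + cst b by [].
  by apply: is_derive_eq; rewrite /GRing.scale /= mulr1 addr0.
have := @is_derive1_comp _ expR (fun h : R => a * h + b) 0 (expR (a * 0 + b)) a.
rewrite mulr0 add0r mulrC; apply => //; exact: is_derive_expR.
Qed.

(** At x1 = 0 both partial increments have this form, with [g] the first or the second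
    projection. *)
Lemma expsum_derive (R : realType) (ks : seq (R * R)) (g : R * R -> R) (y : R) :
  is_derive (0 : R) 1
    (fun h : R => \sum_(k <- ks) expR (g k * h + k.2 * y))
    (\sum_(k <- ks) g k * expR (k.2 * y)).
Proof.
elim: ks => [|k ks IH].
  by under eq_fun do rewrite big_nil; rewrite big_nil; exact: is_derive_cst.
under eq_fun do rewrite big_cons; rewrite big_cons.
by apply: is_deriveD => //; exact: is_derive_expR_affine.
Qed.

Lemma expsum_partial1 (R : realType) (ks : seq (R * R)) (y : R) :
  has_partial1 (expsum ks) (0, y) (\sum_(k <- ks) k.1 * expR (k.2 * y)).
Proof.
apply: has_partial1_derive => /=; rewrite /expsum /expo /=.
under eq_fun do under eq_bigr do rewrite add0r.
exact: expsum_derive.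
Qed.

Lemma expsum_partial2 (R : realType) (ks : seq (R * R)) (y : R) :
  has_partial2 (expsum ks) (0, y) (\sum_(k <- ks) k.2 * expR (k.2 * y)).
Proof.
apply: has_partial2_derive => /=; rewrite /expsum /expo /=.
under eq_fun do under eq_bigr do rewrite mulr0 add0r mulrDr addrC.
exact: expsum_derive.
Qed.

Lemma lyapunov_balance (R : realType) (th y : R) :
  \sum_(k <- lyapunov_exponents th) (k.2 - k.1) * expR (k.2 * y) = 0.
Proof. by rewrite !big_cons big_nil /=; ring. Qed.

(** e^(- th x1) and e^(th x2) are at least 1 plus their exponents, and the norm of a point of Omega
    is the maximum of - x1 and x2. *)
Lemma lyapunov_ge (R : realType) (th : R) (x : R * R) :
  0 <= th -> Omega x ->
  1 <= expsum (lyapunov_exponents th) x /\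
  th * `|x| <= expsum (lyapunov_exponents th) x.
Proof.
case: x => x y th0 [/= x0 y0].
rewrite prod_normE maxr_pMr // ler0_norm // ger0_norm // ge_max.
rewrite /expsum !big_cons big_nil /expo /=.
have := expR_ge1Dx (- th * x + 0 * y); have := expR_ge1Dx (0 * x + th * y).
have := expR_ge0 (th * x + 0 * y); have := expR_ge0 (2 * th * x + th * y).
have : 0 <= th * - x by rewrite mulr_ge0 // oppr_ge0.
have : 0 <= th * y by rewrite mulr_ge0.
by clear; move=> *; split; [lra|apply/andP; split; lra].
Qed.

Unset Implicit Arguments.

Theorem theorem4 (R : realType) (beta : R) (hbeta : 0 < beta) :
  exists (c d : R) (K : set (R * R)) (V GV : R * R -> R),
    0 < c /\ 0 < d /\ compact K /\ K `<=` @Omega R /\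
    (forall x, Omega x -> 1 <= V x) /\
    extended_generator beta V GV /\
    (forall A : R, exists M : R,
       forall x, Omega x -> M <= `|x| -> A <= V x) /\
    (forall x2 : R, 0 <= x2 ->
       exists l : R, has_partial1 V (0, x2) l /\ has_partial2 V (0, x2) l) /\
    (forall x, Omega x -> GV x <= - c * V x + d * \1_K x).
Proof.
pose th := beta / 4; have th0 : 0 < th by rewrite divr_gt0.
have [c [d [c0 d0 drift]]] := lyapunov_drift hbeta.
(* Since V >= th |x|, c V >= d as soon as |x| >= N: outside the box, half of the decay 2 c V absorbs
   d. *)
pose N := d / (c * th).
have N0 : 0 < N by rewrite divr_gt0 // mulr_gt0.
have large x : Omega x -> N <= `|x| -> d <= c * expsum (lyapunov_exponents th) x.
  move=> Ox; rewrite /N ler_pdivrMr ?mulr_gt0 // => Nx.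
  apply: (le_trans Nx); rewrite mulrCA ler_pM2l // mulrC.
  exact: (lyapunov_ge (ltW th0) Ox).2.
exists c, d, (`[- N, 0]%classic `*` `[0, N]%classic),
  (expsum (lyapunov_exponents th)), (expsum_gen beta (lyapunov_exponents th)).
split => //; split => //; split.
  by apply: compact_setX; exact: segment_compact.
split.
  by move=> [x y] [/=]; rewrite !in_itv /= => /andP[_ x0] /andP[y0 _].
split; first by move=> x /(lyapunov_ge (ltW th0))[].
split.
  apply: expsum_extended_generator; first exact: ltW.
  exact: lyapunov_balance.
split.
  move=> A; exists (A / th) => x /(lyapunov_ge (ltW th0))[_ h].
  by rewrite ler_pdivrMr // => /le_trans; apply; rewrite mulrC.
split.
  move=> y _; exists (\sum_(k <- lyapunov_exponents th) k.1 * expR (k.2 * y)).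
  split; first exact: expsum_partial1.
  rewrite (_ : \sum_(k <- _) _ = \sum_(k <- lyapunov_exponents th) k.2 * expR (k.2 * y)).
    exact: expsum_partial2.
  (* Equality of the two derivatives is the same balance that put V into the domain of the
     generator. *)
  apply/esym/eqP; rewrite -subr_eq0 -sumrB.
  by under eq_bigr do rewrite -mulrBl; rewrite lyapunov_balance.
move=> x Ox; apply: (le_trans (drift x Ox)); rewrite -/th.
have [V1 _] := lyapunov_ge (ltW th0) Ox.
have V0 : 0 <= c * expsum (lyapunov_exponents th) x by rewrite mulr_ge0 ?(le_trans _ V1) // ltW.
rewrite indicE; have [xK|xK] := boolP (x \in _).
  by move: V0; clear; rewrite mulr1 => *; lra.
have : d <= c * expsum (lyapunov_exponents th) x.
  apply: large => //; rewrite leNgt; apply: contra xK => xN; rewrite inE /= !in_itv /=.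
  case: Ox => -> ->; rewrite !andbT.
  move: xN; rewrite prod_normE gt_max !ltr_norml => /andP[/andP[/ltW-> _] /andP[_ /ltW ->]].
  by [].
by move: V0; clear; rewrite mulr0 => *; lra.
Qed.
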